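(* Let $p$ be a prime and let $\alpha,\beta,\gamma$ be partitions; put $e=\alpha_1$ (the exponent of a group of type $\alpha$). Then $$g_{\alpha,\gamma}^\beta(p)\;=\;\sum_{\Pi}\;\prod_{\ell=2}^{e+1}\frac{\#\mathrm{Aut}_{\mathcal S}\,E(\Pi|_1^\ell;p)}{\#\mathrm{Aut}_{\mathcal S}\,E(\Pi|_2^\ell;p)},$$ where the sum runs over all Klein tableaux $\Pi=[\gamma^0,\ldots,\gamma^e;\varphi^2,\ldots,\varphi^e]$ of type $(\alpha,\beta,\gamma)$.
   Context: Finite abelian $p$-groups. For a partition $\lambda$ put $M(\lambda)=\bigoplus_i\mathbb Z/(p^{\lambda_i})$. The type of a finite abelian $p$-group $B$ is the partition $\beta$ with $B\cong M(\beta)$; equivalently $\beta'_i=\dim_{\mathbb Z/(p)}p^{i-1}B/p^iB$, where $\lambda'$ denotes the conjugate partition. The classical Hall number $g_{\alpha,\gamma}^\beta(p)$ is the number of subgroups $U\subseteq M(\beta)$ with $U\cong M(\alpha)$ and $M(\beta)/U\cong M(\gamma)$. The category $\mathcal S$: objects are embeddings $(A\subset B)$ of a subgroup $A$ in a finite abelian $p$-group $B$ (equivalently short exact sequences $0\to A\to B\to B/A\to 0$); a morphism $(A\subset B)\to(A'\subset B')$ is a homomorphism $f:B\to B'$ with $f(A)\subseteq A'$. $\mathrm{Aut}_{\mathcal S}$ denotes the automorphism group in $\mathcal S$. Diagrams. A partition $\lambda$ is drawn with its $i$-th column consisting of $\lambda_i$ boxes; rows are numbered $1,2,\dots$ from the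 top, so row $m$ has $\lambda'_m$ boxes. Klein tableaux. A Klein tableau $\Pi=[\gamma^0,\ldots,\gamma^e;\varphi^2,\ldots,\varphi^e]$ consists of partitions with $\gamma^{\ell-1}_i\le\gamma^\ell_i\le\gamma^{\ell-1}_i+1$ for all $1\le\ell\le e$ and all $i$, satisfying for all $2\le\ell\le e$ and $k\ge1$: $\sum_{i\ge k}(\gamma^\ell_i-\gamma^{\ell-1}_i)\le\sum_{i\ge k}(\gamma^{\ell-1}_i-\gamma^{\ell-2}_i)$; and of maps $\varphi^\ell$ ($2\le\ell\le e$) from the set of boxes of the skew diagram $\gamma^\ell\setminus\gamma^{\ell-1}$ to the positive integers such that: (i) $\varphi^\ell$ is weakly increasing from left to right within each row; (ii) if the box $b$ lies in row $m$ then $\varphi^\ell(b)<m$; (iii) if $b$ lies in row $m$ and the box directly above $b$ (row $m-1$, same column) belongs to $\gamma^{\ell-1}\setminus\gamma^{\ell-2}$, then $\varphi^\ell(b)=m-1$; (iv) for each $r$, the number of boxes $b$ with $\varphi^\ell(b)=r$ is at most the number of boxes of $\gamma^{\ell-1}\setminus\gamma^{\ell-2}$ in row $r$. Boxes of $\gamma^0$ are called empty, boxes of $\gamma^\ell\setminus\gamma^{\ell-1}$ are labelled $\ell$, and a box $b$ labelled $\ell\ge2$ with $\varphi^\ell(b)=r$ is a symbol $\ell_r$. The type of $\Pi$ is $(\alpha,\beta,\gamma)$ where $\beta=\gamma^e$, $\gamma=\gamma^0$ and $\alpha'_\ell=|\gamma^\ell\setminus\gamma^{\ell-1}|$ for $1\le\ell\le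 e$. Klein tableau of an embedding $E=(A\subset B)$, with $e$ the exponent of $A$: $\gamma^i=\mathrm{type}(B/p^iA)$, and $\varphi^\ell$ is the unique row-wise weakly increasing assignment such that for $r\ge1$ the number of boxes of $\gamma^\ell\setminus\gamma^{\ell-1}$ in row $m$ with subscript $r$ equals $(\gamma^{\ell,r})'_m-(\gamma^{\ell,r-1})'_m$, where $\gamma^{\ell,r}=\mathrm{type}\big(B/(p^\ell A+p(p^{\ell-2}A\cap p^rB))\big)$. This is a Klein tableau $\Pi(E)$, and every Klein tableau arises this way. Restrictions. For $u\le\ell$, $\Pi|_u^\ell=[\gamma^{\ell-u},\ldots,\gamma^\ell;\varphi^{\ell-u+2},\ldots,\varphi^\ell]$, regarded as a Klein tableau in which the stripe $\gamma^{\ell-u+j}\setminus\gamma^{\ell-u+j-1}$ is labelled $j$ (subscripts retained); here $\gamma^j:=\gamma^e$ for $j>e$ (with empty subscript functions for these stripes). For a Klein tableau $\Pi$ with $e\le2$, $E(\Pi;p)$ denotes the embedding of finite abelian $p$-groups with Klein tableau $\Pi$; it is unique up to isomorphism in $\mathcal S$. *)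

(* Defs.v *)
From HB Require Import structures.
From mathcomp Require Import all_boot all_order all_algebra all_fingroup all_solvable.
From mathcomp Require Import boolp.
Set Implicit Arguments. Unset Strict Implicit. Unset Printing Implicit Defensive.

(* A partition is a non-increasing sequence of positive integers
   (lambda_1 >= lambda_2 >= ... > 0); lambda_i = nth 0 lambda (i-1). *)
Definition is_partition (l : seq nat) : bool := sorted geq l && all (leq 1) l.

Definition conj (l : seq nat) (m : nat) : nat := count (fun x => m <= x) l.

(* M(lambda) = Z/(p^lambda_1) x Z/(p^lambda_2) x ... ; the cyclic group Z/(n)
   is the additive group 'I_n (written 'I_(n.-1.+1), n = p^k >= 1). *)
Fixpoint Mty (p : nat) (l : seq nat) : finGroupType :=
  match l with
  | [::] => 'I_1
  | k :: l' => ('I_(p ^ k).-1.+1 * Mty p l')%type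
  end.

(* type of a finite abelian p-group: the partition beta with G ~ M(beta),
   read off from the library's abelian_type (orders of cyclic factors). *)
Definition typ (p : nat) {gT : finGroupType} (G : {set gT}) : seq nat :=
  map (logn p) (abelian_type G).

Definition hall (p : nat) (alpha beta gamma : seq nat) : nat :=
  #|[set U : {group Mty p beta} |
      (typ p U == alpha) && (typ p ([set: Mty p beta] / U)%g == gamma)]|.

Definition autS_card {gT : finGroupType} (A B : {set gT}) : nat :=
  #|[set a in Aut B | a @: A \subset A]|.

(* A tableau is a pair (gs, phs): gs = [gamma^0; ...; gamma^e] and
   phs = [phi^2; ...; phi^e].  Columns are indexed from 0: column i of a
   partition l has nth 0 l i boxes.  Since gamma^(l-1)_i <= gamma^l_i <=
   gamma^(l-1)_i + 1, the stripe gamma^l \ gamma^(l-1) has at most one box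
   per column, namely in row gamma^l_i; phi^l is stored as a seq nat whose
   i-th entry is the subscript of the box in column i (0 if no box). *)
Definition tableau := (seq (seq nat) * seq (seq nat))%type.

Definition nst (T : tableau) : nat := (size T.1).-1.
Definition gam (T : tableau) (j : nat) : seq nat := nth [::] T.1 j.
Definition phi (T : tableau) (l : nat) : seq nat := nth [::] T.2 (l - 2).

Definition isbox (T : tableau) (l i : nat) : bool :=
  nth 0 (gam T l) i == (nth 0 (gam T l.-1) i).+1.
Definition row (T : tableau) (l i : nat) : nat := nth 0 (gam T l) i.
Definition sub (T : tableau) (l i : nat) : nat := nth 0 (phi T l) i.

Definition nbox (T : tableau) (l : nat) : nat :=
  #|[set i : 'I_(size (gam T l)) | isbox T l i]|.
Definition nbox_row (T : tableau) (l m : nat) : nat :=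
  #|[set i : 'I_(size (gam T l)) | isbox T l i && (row T l i == m)]|.
Definition nbox_sub (T : tableau) (l r : nat) : nat :=
  #|[set i : 'I_(size (gam T l)) | isbox T l i && (sub T l i == r)]|.

Definition tailsum (T : tableau) (l k : nat) : nat :=
  \sum_(k.-1 <= i < size (gam T l)) (nth 0 (gam T l) i - nth 0 (gam T l.-1) i).

Definition is_klein (T : tableau) : Prop :=
  [/\ [/\ 0 < size T.1,
      size T.2 = (nst T).-1 &
      forall j, j <= nst T -> is_partition (gam T j)],
      (forall l i, 1 <= l <= nst T ->
          nth 0 (gam T l.-1) i <= nth 0 (gam T l) i <= (nth 0 (gam T l.-1) i).+1),
      (forall l k, 2 <= l <= nst T -> 1 <= k -> tailsum T l k <= tailsum T l.-1 k) &
      forall l, 2 <= l <= nst T ->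
       [/\ [/\ size (phi T l) = size (gam T l) &
           (* entries outside the stripe are 0 (canonical representation) *)
           (forall i, ~~ isbox T l i -> sub T l i = 0)],
           (forall i, isbox T l i -> 0 < sub T l i < row T l i),
           (forall i j, i < j -> isbox T l i -> isbox T l j -> row T l i = row T l j ->
               sub T l i <= sub T l j),
           (* (iii) box directly above belongs to gamma^(l-1) \ gamma^(l-2) *)
           (forall i, isbox T l i -> isbox T l.-1 i -> sub T l i = (row T l i).-1) &
           (forall r, nbox_sub T l r <= nbox_row T l.-1 r)]].

Definition klein_type (T : tableau) (alpha beta gamma : seq nat) : Prop :=
  [/\ nst T = head 0 alpha, size T.1 = (head 0 alpha).+1,
      gam T (nst T) = beta, gam T 0 = gamma &
      forall l, 1 <= l <= nst T -> conj alpha l = nbox T l].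

Definition gamlr (p : nat) {gT : finGroupType} (A B : {group gT}) (l r : nat) :=
  typ p (B / (Mho l A <*> Mho 1 (Mho (l - 2) A :&: Mho r B)))%g.

(* (A subset B) has Klein tableau T (T with e = nst T stripes, e >= exponent
   of A: for stripes beyond the exponent gamma^j = gamma^e, empty stripes). *)
Definition has_klein (p : nat) {gT : finGroupType} (A B : {group gT}) (T : tableau)
  : Prop :=
  [/\ A \subset B, Mho (nst T) A = 1%g,
      (forall j, j <= nst T -> gam T j = typ p (B / Mho j A)%g) &
      forall l, 2 <= l <= nst T ->
       [/\ (forall i, isbox T l i -> 0 < sub T l i),
           (forall i j, i < j -> isbox T l i -> isbox T l j -> row T l i = row T l j ->
               sub T l i <= sub T l j) &
           forall m r, 1 <= m -> 1 <= r ->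
             #|[set i : 'I_(size (gam T l)) |
                  (isbox T l i && ((row T l i == m) && (sub T l i == r)))]|
             + conj (gamlr p A B l r.-1) m = conj (gamlr p A B l r) m]].

Definition autS_tab (p : nat) (T : tableau) : nat :=
  let beta := gam T (nst T) in
  match [pick A : {group Mty p beta} | `[< has_klein p A [set: Mty p beta]%G T >] ] with
  | Some A => autS_card A [set: Mty p beta]
  | None => 0
  end.

Definition gext (T : tableau) (j : nat) : seq nat :=
  if j <= nst T then gam T j else gam T (nst T).
Definition phext (T : tableau) (j : nat) : seq nat :=
  if j <= nst T then phi T j else [::].
Definition restr (T : tableau) (u l : nat) : tableau :=
  ([seq gext T j | j <- iota (l - u) u.+1],
   [seq phext T j | j <- iota (l - u + 2) u.-1]).

(* Main.v *)
Require Import Defs.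
From HB Require Import structures.
From mathcomp Require Import all_boot all_order all_algebra all_fingroup all_solvable.
From mathcomp Require Import boolp zify.
Set Implicit Arguments. Unset Strict Implicit. Unset Printing Implicit Defensive.

(* The subgroups U of B = M(beta) are counted by their Klein tableau T.  A subgroup with
   tableau T is reached along the chain p^e U < p^(e-1) U < ... < U: the groups F with
   p F = D given correspond, via F |-> F / pD, to the subgroups Y of Q = B / pD with
   tableau T|_2^l and p Y = D / pD.  Embeddings with p^2 Y = 0 are determined up to
   automorphisms of Q by their tableau (Kaplansky's extension of height-preserving
   isomorphisms), so by orbit-stabilizer the number of such Y is the ratio of the
   automorphism counts of T|_1^l and T|_2^l.  If some T|_2^l is not realized, the
   denominator is 0, the ratio is x / 0 = 0, and indeed no U has tableau T; hence the
   existence of embeddings with a given tableau is not needed.  It remains to see that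
   the tableau of every subgroup satisfies the combinatorial axioms; each of these is an
   instance of |H : K| >= |pH : pK|. *)

(** * Partitions and tableaux *)

(** A tableau records only types of quotients B/Y, whereas automorphisms are built from elements and
    their heights. The two meet in the orders of Y :&: p^m B, which are determined by the types of B
    and B/Y. For p^2 X = 0 a two-stripe tableau thus prescribes the orders of X :&: p^m B and of p(X
    :&: p^r B) :&: p^m B, and uniqueness is derived from these numbers alone: the image of a new
    element is found by counting what a partial isomorphism has not yet reached. Passing to B / pD
    is harmless because pD = p^2 F lies in every subgroup of B by which one divides to obtain the
    first two stripes of F, except that F itself only has to contain it. The factor l belongs to the
    step from k = e+1-l to k+1 stripes. For l = e+1 this is the step from the trivial group to an
    elementary abelian one, which is why restrictions repeat gamma^e beyond e. Automorphism counts
    are defined in M(beta) but the fibres live in a quotient of B, so each ratio is carried along an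
    isomorphism. *)

Lemma conj_cons x l m : conj (x :: l) m = (m <= x) + conj l m.
Proof. by []. Qed.

Lemma partition_cons x l : is_partition (x :: l) -> is_partition l.
Proof.
by case/andP=> /path_sorted sl /= /andP[_ al]; apply/andP.
Qed.

Lemma partition_le_head x l i : is_partition (x :: l) -> nth 0 l i <= x.
Proof.
case/andP=> /= pl _; have [ltil|geil] := ltnP i (size l); last by rewrite nth_default.
have := order_path_min (rev_trans leq_trans) pl.
by move/allP=> /(_ _ (mem_nth 0 ltil)).
Qed.

(** Galois connection between a partition and its conjugate; every passage between rows, which
    groups provide, and columns, which tableaux store, goes through it. *)
Lemma ltn_conj l m i : is_partition l -> 0 < m -> (i < conj l m) = (m <= nth 0 l i).
Proof.
move=> + m_gt0; elim: l i => [|x l IHl] i pl; first by rewrite nth_nil /conj /=; lia.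
have pl' := partition_cons pl; rewrite conj_cons.
have [lemx|ltxm] := leqP m x.
  by case: i => [|i] //=; rewrite add1n ltnS IHl.
have nth_lt j : nth 0 (x :: l) j < m.
  by case: j => [|j] //=; apply: leq_ltn_trans ltxm; apply: partition_le_head.
rewrite add0n [RHS]leqNgt nth_lt /=; apply/negbTE; rewrite IHl // -ltnNge.
exact: (nth_lt i.+1).
Qed.

Lemma size_partition l : is_partition l -> size l = conj l 1.
Proof.
case/andP=> _ /all_filterP all_l.
by rewrite /conj -size_filter all_l.
Qed.

Lemma nth_partition_gt0 l i : is_partition l -> (0 < nth 0 l i) = (i < size l).
Proof. by move=> pl; rewrite size_partition // ltn_conj. Qed.

Lemma eq_partition_nth l1 l2 :
  is_partition l1 -> is_partition l2 -> (forall i, nth 0 l1 i = nth 0 l2 i) -> l1 = l2.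
Proof.
move=> p1 p2 eq12; have eqs i : (i < size l1) = (i < size l2).
  by rewrite -!nth_partition_gt0 ?eq12.
have es : size l1 = size l2 by have := eqs (size l1); have := eqs (size l2); lia.
exact: (eq_from_nth (x0 := 0)).
Qed.

Lemma nth_partition_le l i j : is_partition l -> i <= j -> nth 0 l j <= nth 0 l i.
Proof.
move=> pl leij; case E: (nth 0 l j) => [|m] //.
rewrite -ltn_conj //; apply: leq_ltn_trans leij _.
by rewrite ltn_conj ?E.
Qed.

Lemma leq_nth_conj l1 l2 :
    is_partition l1 -> is_partition l2 -> (forall m, conj l1 m.+1 <= conj l2 m.+1) ->
  forall i, nth 0 l1 i <= nth 0 l2 i.
Proof.
move=> p1 p2 le12 i; case E: (nth 0 l1 i) => [|m] //.
rewrite -ltn_conj //; apply: leq_trans (le12 m).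
by rewrite ltn_conj ?E.
Qed.

Lemma leq_nthS_conj l1 l2 :
    is_partition l1 -> is_partition l2 -> (forall m, conj l1 m.+2 <= conj l2 m.+1) ->
  forall i, nth 0 l1 i <= (nth 0 l2 i).+1.
Proof.
move=> p1 p2 le12 i; case E: (nth 0 l1 i) => [|[|m]] //.
rewrite ltnS -ltn_conj //; apply: leq_trans (le12 m).
by rewrite ltn_conj ?E.
Qed.

Lemma eq_partition_conj l1 l2 :
  is_partition l1 -> is_partition l2 -> (forall m, conj l1 m.+1 = conj l2 m.+1) -> l1 = l2.
Proof.
move=> p1 p2 eq12; apply: eq_partition_nth => // i.
by apply/eqP; rewrite eqn_leq !leq_nth_conj // => m; rewrite eq12.
Qed.

Lemma card_set_count n (P : pred nat) : #|[set i : 'I_n | P i]| = count P (iota 0 n).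
Proof. by rewrite -sum1dep_card -(big_mkord P (fun=> 1)) sum1_count /index_iota subn0. Qed.

Lemma card_ord_interval n a b : b <= n -> #|[set i : 'I_n | a <= i < b]| = b - a.
Proof.
move=> lebn; rewrite (@card_set_count n (fun i => a <= i < b)).
suff -> : count (fun i => a <= i < b) (iota 0 n) = minn b n - a by rewrite (minn_idPl lebn).
elim: n {lebn} => [|n IHn]; first by rewrite minn0.
by rewrite -addn1 iotaD count_cat IHn /= add0n addn1; lia.
Qed.

Lemma sum_nth (F : nat -> nat) l n : F 0 = 0 -> size l <= n ->
  \sum_(x <- l) F x = \sum_(0 <= i < n) F (nth 0 l i).
Proof.
move=> F0 len; rewrite (big_nth 0) (big_cat_nat _ len) //=.
rewrite [X in _ = _ + X]big_nat_cond [X in _ = _ + X]big1 ?addn0 // => i /andP[/andP[lei _] _].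
by rewrite nth_default.
Qed.

Lemma leq_size_nth l1 l2 : is_partition l1 -> is_partition l2 ->
  (forall i, nth 0 l1 i <= nth 0 l2 i) -> size l1 <= size l2.
Proof.
move=> p1 p2 le12; rewrite leqNgt -nth_partition_gt0 // -leqNgt.
by apply: leq_trans (le12 _) _; rewrite nth_default.
Qed.

Lemma leq_conj_nth l1 l2 m : is_partition l1 -> is_partition l2 -> 0 < m ->
  (forall i, nth 0 l1 i <= nth 0 l2 i) -> conj l1 m <= conj l2 m.
Proof.
move=> p1 p2 m0 le12; rewrite leqNgt ltn_conj // -ltnNge.
by apply: leq_ltn_trans (le12 _) _; rewrite ltnNge -ltn_conj // ltnn.
Qed.

Definition strip (g0 g1 : seq nat) : Prop :=
  forall i, nth 0 g0 i <= nth 0 g1 i <= (nth 0 g0 i).+1.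

Lemma card_boxes n g0 g1 : strip g0 g1 -> size g0 <= n -> size g1 <= n ->
  #|[set i : 'I_n | nth 0 g1 i == (nth 0 g0 i).+1]| + sumn g0 = sumn g1.
Proof.
move=> st le0 le1; rewrite -sum1dep_card big_mkcond /=.
rewrite -(big_mkord xpredT (fun i => if nth 0 g1 i == (nth 0 g0 i).+1 then 1 else 0)).
have sumnE l : size l <= n -> sumn l = \sum_(0 <= i < n) nth 0 l i.
  by move=> lel; rewrite sumnE (sum_nth (F := id) _ lel).
rewrite !sumnE // -big_split /=; apply: eq_bigr => i _.
by have := st i; case: eqP; lia.
Qed.

(** Both diagrams are left-justified, so the boxes of a stripe in one row occupy consecutive
    columns. A weakly increasing filling of a row is therefore determined by how often each
    subscript occurs. *)
Lemma box_row_interval g0 g1 m i : is_partition g0 -> is_partition g1 -> strip g0 g1 -> 0 < m ->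
  (nth 0 g1 i == (nth 0 g0 i).+1) && (nth 0 g1 i == m) = (conj g0 m <= i < conj g1 m).
Proof.
move=> p0 p1 st m0; rewrite leqNgt !ltn_conj //; have := st i.
by case: eqP; case: eqP; lia.
Qed.

Lemma card_boxes_row n g0 g1 m : is_partition g0 -> is_partition g1 -> strip g0 g1 -> 0 < m ->
  size g1 <= n ->
  #|[set i : 'I_n | (nth 0 g1 i == (nth 0 g0 i).+1) && (nth 0 g1 i == m)]| + conj g0 m
    = conj g1 m.
Proof.
move=> p0 p1 st m0 le1.
rewrite (eq_card (B := [set i : 'I_n | conj g0 m <= i < conj g1 m])); last first.
  by move=> i; rewrite !inE box_row_interval.
rewrite card_ord_interval ?subnK ?leq_conj_nth // => [i|]; first by case/andP: (st i).
exact: leq_trans (count_size _ _) le1.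
Qed.

(* The boxes of nu \ mu and of mu \ la in columns >= k are compared first for the columns
   >= s, where s is the first column of mu shorter than nu_k; between s and k every column
   contains a box of nu \ mu. *)
Lemma lattice_condition la mu nu :
    is_partition la -> is_partition mu -> is_partition nu -> strip la mu -> strip mu nu ->
    (forall t, \sum_(x <- nu) minn x t.+1 + \sum_(x <- la) minn x t
      <= \sum_(x <- mu) minn x t.+1 + \sum_(x <- mu) minn x t) ->
  forall k, \sum_(k <= i < size nu) (nth 0 nu i - nth 0 mu i)
    <= \sum_(k <= i < size mu) (nth 0 mu i - nth 0 la i).
Proof.
move=> pl pm pn stlm stmn ineq k; set n := size nu.
have lemn : size mu <= n by apply: leq_size_nth => // i; case/andP: (stmn i).
have leln : size la <= n.
  by apply: leq_trans lemn; apply: leq_size_nth => // i; case/andP: (stlm i).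
pose TA j := \sum_(j <= i < n) (nth 0 nu i - nth 0 mu i).
pose TB j := \sum_(j <= i < n) (nth 0 mu i - nth 0 la i).
have -> : \sum_(k <= i < size mu) (nth 0 mu i - nth 0 la i) = TB k.
  rewrite (big_nat_widen _ _ _ _ _ lemn) big_mkcond /=; apply: eq_bigr => i _.
  by case: ltnP => // lei; rewrite nth_default.
rewrite -/(TA k).
have TAS j : j < n -> TA j = (nth 0 nu j - nth 0 mu j) + TA j.+1.
  by move=> ltj; rewrite /TA big_ltn.
have TBS j : j < n -> TB j = (nth 0 mu j - nth 0 la j) + TB j.+1.
  by move=> ltj; rewrite /TB big_ltn.
(* In a column before s one has [mu] >= t+1, so the truncations of [nu] and [mu] at t+1 agree, and
   so do those of [mu] and [la] at t. From s on no truncation has any effect. Hence [ineq t] reduces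
   to the comparison of the two tails at s. *)
have first_col t : TA (conj mu t.+1) <= TB (conj mu t.+1).
  set s := conj mu t.+1; have les : s <= n by apply: leq_trans lemn; apply: count_size.
  have := ineq t; rewrite !(@sum_nth (fun x => minn x _) _ n) ?min0n //.
  have cat (F : nat -> nat) :
      \sum_(0 <= i < n) F i = \sum_(0 <= i < s) F i + \sum_(s <= i < n) F i.
    by rewrite (big_cat_nat _ les).
  rewrite !cat.
  have before (F G : nat -> nat) : (forall i, i < s -> F i = G i) ->
      \sum_(0 <= i < s) F i = \sum_(0 <= i < s) G i.
    by move=> FG; apply: eq_big_nat => i /andP[_ lti]; apply: FG.
  have after (F G a : nat -> nat) : (forall i, s <= i -> F i = G i + a i) ->
      \sum_(s <= i < n) F i = \sum_(s <= i < n) G i + \sum_(s <= i < n) a i.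
    by move=> FG; rewrite -big_split; apply: eq_big_nat => i /andP[lei _]; apply: FG.
  rewrite (before _ (fun i => minn (nth 0 mu i) t.+1)) => [|i]; last first.
    by rewrite ltn_conj //; have := stmn i; lia.
  rewrite [X in _ + (X + _)](before _ (fun i => minn (nth 0 mu i) t)) => [|i]; last first.
    by rewrite ltn_conj //; have := stlm i; lia.
  rewrite (after _ (fun i => minn (nth 0 mu i) t.+1) (fun i => nth 0 nu i - nth 0 mu i)); last first.
    by move=> i; rewrite leqNgt ltn_conj //; have := stmn i; lia.
  rewrite -/(TA s).
  rewrite [X in _ <= _ + (_ + X)](after _ (fun i => minn (nth 0 la i) t) (fun i => nth 0 mu i - nth 0 la i)).
    by rewrite -/(TB s); lia.
  by move=> i; rewrite leqNgt ltn_conj //; have := stlm i; lia.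
move: {2}(n - k) (leqnn (n - k)) => N; elim: N k => [|N IHN] k leN.
  by rewrite /TA big_geq //; lia.
have [ltk|lek] := ltnP k n; last by rewrite /TA big_geq //; lia.
have leN' : n - k.+1 <= N by lia.
have [ak|ak] := eqVneq (nth 0 nu k) (nth 0 mu k).
  by rewrite TAS // TBS // ak subnn; have := IHN _ leN'; lia.
pose t := nth 0 mu k; pose s := conj mu t.+1.
have nuk : nth 0 nu k = t.+1 by have := stmn k; rewrite -/t; move: ak; rewrite -/t; lia.
have lesk : s <= k by rewrite leqNgt ltn_conj // -/t ltnn.
(* Going left from k to s, [TA] gains exactly one box per column and [TB] at most one, so the
   comparison at s carries over to k. *)
have TAk j : j <= k - s -> TA (k - j) = TA k + j /\ TB (k - j) <= TB k + j.
  elim: j => [|j IHj] lej; first by rewrite subn0 !addn0.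
  have [IHA IHB] := IHj (ltnW lej); have lt1 : k - j.+1 < n by lia.
  rewrite TAS // TBS // (_ : (k - j.+1).+1 = k - j); last by lia.
  rewrite IHA; have := stlm (k - j.+1); have := stmn (k - j.+1).
  have nuj : t.+1 <= nth 0 nu (k - j.+1) by rewrite -nuk nth_partition_le // leq_subr.
  have muj : nth 0 mu (k - j.+1) <= t.
    by rewrite -ltnS ltnNge -ltn_conj // -leqNgt -/s; lia.
  by lia.
have := first_col t; rewrite -/s; have [] := TAk (k - s) (leqnn _).
by rewrite subKn //; lia.
Qed.

(* The conditions of [has_klein] on one stripe g1 \ g0 with subscripts f, where [h r]
   stands for the partition of boxes with subscript at most r. *)
Definition stripe (g1 g0 f : seq nat) (h : nat -> seq nat) : Prop :=
  let box i := nth 0 g1 i == (nth 0 g0 i).+1 in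
  [/\ forall i, box i -> 0 < nth 0 f i,
      forall i j, i < j -> box i -> box j -> nth 0 g1 i = nth 0 g1 j ->
        nth 0 f i <= nth 0 f j &
      forall m r, 0 < m -> 0 < r ->
        #|[set i : 'I_(size g1) | box i && ((nth 0 g1 i == m) && (nth 0 f i == r))]|
          + conj (h r.-1) m = conj (h r) m].

(** * Subscripts read off from a chain of partitions *)

Section FirstSubscript.

Variables (g1 g2 : seq nat) (h : nat -> seq nat) (N : nat).
Hypotheses (p1 : is_partition g1) (p2 : is_partition g2) (ph : forall r, is_partition (h r)).
Hypotheses (st12 : strip g1 g2) (h0 : h 0 = g1) (hN : h N = g2).
Hypothesis h_mono : forall r i, nth 0 (h r) i <= nth 0 (h r.+1) i.
Hypothesis h_le : forall r i, nth 0 (h r) i <= nth 0 g2 i.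

(** The box of column i is added at exactly one step of the chain h 0, h 1, ..., h N from g1 to g2,
    and the index of that step is its subscript. The bound N serves only to make the search
    finite. *)
Definition first_subscript (g1 g2 : seq nat) (h : nat -> seq nat) (N : nat) (i : nat) : nat :=
  if nth 0 g2 i == (nth 0 g1 i).+1
  then find (fun r => nth 0 (h r) i == nth 0 g2 i) (iota 0 N.+1) else 0.

Local Notation box i := (nth 0 g2 i == (nth 0 g1 i).+1).
Local Notation f := (first_subscript g1 g2 h N).

Lemma h_homo r s i : r <= s -> nth 0 (h r) i <= nth 0 (h s) i.
Proof.
move=> /subnK <-; elim: (s - r) => // k IHk.
exact: leq_trans IHk (h_mono _ _).
Qed.

Lemma first_subscript_le i r : box i -> (f i <= r) = (nth 0 (h r) i == nth 0 g2 i).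
Proof.
move=> bi; rewrite /first_subscript bi; set P := fun r => _; set s := iota 0 N.+1.
have hasP : has P s by apply/hasP; exists N; rewrite ?mem_iota ?leqnn //= /P hN.
have lt_find : find P s < N.+1 by move: hasP; rewrite has_find size_iota.
have Pf := nth_find 0 hasP; rewrite nth_iota // add0n in Pf.
apply/idP/idP=> [le | Pr].
  by rewrite eqn_leq h_le -(eqP Pf) h_homo.
rewrite leqNgt; apply/negP=> lt; have := before_find 0 lt.
by rewrite nth_iota ?add0n ?(ltn_trans lt) // /P Pr.
Qed.

Lemma first_subscript_nobox i : ~~ box i -> f i = 0.
Proof. by rewrite /first_subscript => /negbTE->. Qed.

Lemma nth_mkseq_first n i : size g2 <= n -> nth 0 (mkseq f n) i = f i.
Proof.
move=> len; have [lti|lei] := ltnP i n; first by rewrite nth_mkseq.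
rewrite nth_default ?size_mkseq // first_subscript_nobox //.
by rewrite (nth_default _ (leq_trans len lei)).
Qed.

Lemma first_subscript_gt0 i : box i -> 0 < f i.
Proof. by move=> bi; rewrite ltnNge first_subscript_le // h0 (eqP bi) ltn_eqF. Qed.

Lemma first_subscript_eq i r : 0 < r ->
  box i && (f i == r) = (nth 0 (h r) i == (nth 0 (h r.-1) i).+1).
Proof.
case: r => // r _; have := h_le r.+1 i; have := h_le r i; have := h_mono r i.
have := h_homo i (leq0n r); rewrite h0; have := st12 i; case: eqP => [/eqP bi | nb] /=; last by lia.
have := first_subscript_le r bi; have := first_subscript_le r.+1 bi.
by move: bi; case: eqP; case: eqP; lia.
Qed.

Lemma strip_h r : strip (h r) (h r.+1).
Proof.
move=> i; rewrite h_mono; have := h_le r.+1 i; have := h_homo i (leq0n r); rewrite h0.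
by have := st12 i; lia.
Qed.

Lemma stripe_first : stripe g2 g1 (mkseq f (size g2)) h.
Proof.
split=> [i bi | i j ltij bi bj eqrow | m r m0 r0]; rewrite ?nth_mkseq_first //.
- exact: first_subscript_gt0.
(* The partition h (f j) attains the height of [g2] in column j, hence also in the earlier column i,
   where [g2] has the same height; so f i <= f j. *)
- have fj := first_subscript_le (f j) bj; rewrite leqnn in fj.
  rewrite first_subscript_le // eqn_leq h_le eqrow -(eqP (esym fj)).
  by rewrite nth_partition_le // ltnW.
rewrite (eq_card (B := [set i : 'I_(size g2) |
   (nth 0 (h r) i == (nth 0 (h r.-1) i).+1) && (nth 0 (h r) i == m)])); last first.
  move=> i; rewrite !inE nth_mkseq_first // andbCA first_subscript_eq //.
  have := h_le r i; have := st12 i; have := h_homo i (leq0n r.-1); rewrite h0.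
  by case: eqP; case: eqP; case: eqP; lia.
case: r r0 => // r _ /=; apply: card_boxes_row => //; first exact: strip_h.
by apply: leq_size_nth.
Qed.

Lemma card_first_subscript r : 0 < r ->
  #|[set i : 'I_(size g2) | box i && (f i == r)]| + sumn (h r.-1) = sumn (h r).
Proof.
move=> r0; rewrite (eq_card (B := [set i : 'I_(size g2) |
   nth 0 (h r) i == (nth 0 (h r.-1) i).+1])); last first.
  by move=> i; rewrite !inE first_subscript_eq.
case: r r0 => // r _ /=; apply: card_boxes; first exact: strip_h.
  by apply: leq_size_nth.
by apply: leq_size_nth.
Qed.

End FirstSubscript.

(** In row m the boxes with subscript at most r form an initial segment, by monotonicity, and the
    counts fix its length. So the chain h determines the subscripts, which yields uniqueness of the
    tableau of an embedding. *)
Lemma stripe_subscript_le g1 g2 f h i r :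
    is_partition g1 -> is_partition g2 -> strip g1 g2 -> h 0 = g1 -> stripe g2 g1 f h ->
    nth 0 g2 i == (nth 0 g1 i).+1 ->
  (nth 0 f i <= r) = (i < conj (h r) (nth 0 g2 i)).
Proof.
move=> p1 p2 st12 h0 [f_gt0 f_mono f_count] bi; set m := nth 0 g2 i.
have m0 : 0 < m by rewrite /m (eqP bi).
pose S s := [set j : 'I_(size g2) | ((nth 0 g2 j == (nth 0 g1 j).+1) && (nth 0 g2 j == m)) && (nth 0 f j <= s)].
have cardS s : #|S s| + conj g1 m = conj (h s) m.
  elim: s => [|s IHs].
    rewrite h0 -[RHS]add0n; congr (_ + _); apply/eqP; rewrite cards_eq0; apply/eqP/setP=> j.
    by rewrite !inE; apply/negP=> /andP[/andP[/f_gt0]]; lia.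
  rewrite -(f_count m s.+1) //= -IHs addnA; congr (_ + _).
  rewrite addnC -cardsUI; set I := _ :&: _; have -> : I = set0.
    apply/setP=> j; rewrite !inE; apply/negP.
    by case/andP=> /andP[_ le] /andP[_ /andP[_ /eqP eq]]; move: le; rewrite eq ltnn.
  rewrite cards0 addn0; apply: eq_card => j; rewrite !inE.
  by case: (_ == (_).+1) => //=; case: (_ == m) => //=; rewrite leq_eqVlt ltnS orbC.
have lt_i : i < size g2 by rewrite -nth_partition_gt0.
have in_row : conj g1 m <= i < conj g2 m by rewrite -box_row_interval // bi eqxx.
have le2 : conj g2 m <= size g2 := count_size _ _.
have rowP j : conj g1 m <= j < conj g2 m ->
    (nth 0 g2 j == (nth 0 g1 j).+1) && (nth 0 g2 j == m) by rewrite -box_row_interval.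
apply/idP/idP=> [le_r | ].
  have sSI : [set j : 'I_(size g2) | conj g1 m <= j < i.+1] \subset S r.
    apply/subsetP=> j; rewrite !inE => /andP[lej leji].
    have rj : conj g1 m <= j < conj g2 m by lia.
    have /andP[bj /eqP rowj] := rowP j rj; rewrite bj rowj eqxx /=.
    have [->|neij] := eqVneq (nat_of_ord j) i; first exact: le_r.
    apply: leq_trans le_r; apply: (f_mono _ _ _ bj bi rowj).
    by rewrite ltn_neqAle neij -ltnS.
  have := subset_leq_card sSI; rewrite card_ord_interval //; have := cardS r; lia.
rewrite -ltnS => lt_c; rewrite leqNgt; apply/negP=> lt_r.
have sSI : S r \subset [set j : 'I_(size g2) | conj g1 m <= j < i].
  apply/subsetP=> j; rewrite !inE => /andP[rj lej].
  have /andP[-> _] : conj g1 m <= j < conj g2 m by rewrite -box_row_interval.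
  rewrite /= ltnNge; apply/negP=> leij; case/andP: rj => bj /eqP rowj.
  have [eqij|neij] := eqVneq i j; first by move: lt_r; rewrite eqij ltnNge lej.
  have : nth 0 f i <= nth 0 f j by apply: (f_mono _ _ _ bi bj (esym rowj)); rewrite ltn_neqAle neij.
  lia.
have := subset_leq_card sSI; rewrite card_ord_interval ?(ltnW lt_i) //.
have := cardS r; lia.
Qed.

Import GRing.Theory Num.Theory GroupScope.

(** * Types of finite abelian p-groups *)

Section AbelianPGroups.

Variables (p : nat) (gT : finGroupType).
Hypothesis p_pr : prime p.
Implicit Types G H K B Y : {group gT}.

(** Orders enter through their logarithm to base p: product formulas and index comparisons become
    linear and are within reach of [lia]. *)
Local Notation lg A := (logn p #|A|).

Lemma lgS H K : H \subset K -> lg H <= lg K.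
Proof. by move=> sHK; rewrite dvdn_leq_log ?cardG_gt0 ?cardSg. Qed.

Lemma lgY B H K : abelian B -> H \subset B -> K \subset B ->
  lg (H <*> K) + lg (H :&: K) = lg H + lg K.
Proof.
move=> cBB sHB sKB; have cHK : K \subset 'C(H) by apply: sub_abelian_cent2 cBB _ _.
rewrite joingC cent_joinEl // -!lognM ?cardG_gt0 //; last by rewrite -cent_joinEl ?cardG_gt0.
by rewrite [H :&: K]setIC -mul_cardG mulnC.
Qed.

Lemma lg_Ohm_Mho n H : abelian H -> lg ('Ohm_n(H)) + lg ('Mho^n(H)) = lg H.
Proof. by move=> cHH; rewrite -lognM ?cardG_gt0 // mul_card_Ohm_Mho_abelian. Qed.

(** The number of cyclic factors of order at least p^(m+1) is the logarithm of |Ohm_(m+1) : Ohm_m|,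
    and |Ohm_n(G)| |p^n G| = |G| turns this into the index of p^(m+1) G in p^m G. *)
Lemma conj_typ G m : p.-group G -> abelian G ->
  conj (typ p G) m.+1 + lg ('Mho^m.+1(G)) = lg ('Mho^m(G)).
Proof.
move=> pG cGG; have [b defG tb] := abelian_structure cGG.
have -> : conj (typ p G) m.+1 = logn p #|'Ohm_m.+1(G) : 'Ohm_m(G)|.
  rewrite -(count_logn_dprod_cycle p m defG) /conj /typ -tb !count_map.
  by apply: eq_count => x /=.
have sO : 'Ohm_m(G) \subset 'Ohm_m.+1(G) by apply: Ohm_leq.
have := lg_Ohm_Mho m cGG; have := lg_Ohm_Mho m.+1 cGG.
have : lg ('Ohm_m.+1(G)) = lg ('Ohm_m(G)) + logn p #|'Ohm_m.+1(G) : 'Ohm_m(G)|.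
  by rewrite -lognM ?cardG_gt0 // Lagrange.
lia.
Qed.

(** The first m rows of the diagram add up to the logarithm of |G : p^m G|. Truncated sums of this
    kind are what [lattice_condition] compares. *)
Lemma sum_minn_typ G m : p.-group G -> abelian G ->
  \sum_(x <- typ p G) minn x m + lg ('Mho^m(G)) = lg G.
Proof.
move=> pG cG; elim: m => [|m IHm].
  by rewrite big1 ?Mho0 // => x _; rewrite minn0.
rewrite -[RHS]IHm -(conj_typ m pG cG) addnA; congr (_ + _).
elim: (typ p G) => [|x s IHs]; first by rewrite !big_nil.
by rewrite !big_cons conj_cons IHs; lia.
Qed.

Lemma prod_abelian_type G : abelian G -> (\prod_(x <- abelian_type G) x)%N = #|G|.
Proof.
move=> cGG; have [b defG <-] := abelian_structure cGG.
by rewrite big_map (bigdprod_card defG).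
Qed.

Lemma abelian_type_pnat G x : p.-group G -> abelian G -> x \in abelian_type G ->
  p.-nat x.
Proof.
move=> pG cGG xG; apply: pnat_dvd pG; rewrite -(prod_abelian_type cGG).
by rewrite (big_rem _ xG) dvdn_mulr.
Qed.

Lemma typ_partition G : p.-group G -> abelian G -> is_partition (typ p G).
Proof.
move=> pG cGG; apply/andP; split.
  have f_homo : {in [pred x | 0 < x] &, {homo logn p : x y / y %| x >-> y <= x}}.
    by move=> x y x_gt0 y_gt0 /= dvd; apply: dvdn_leq_log.
  apply: (homo_sorted_in f_homo); last exact: abelian_type_dvdn_sorted.
  by apply/allP=> x /(allP (abelian_type_gt1 G)) /= /ltnW.
apply/allP=> _ /mapP[x xG ->].
have /p_natP[k def_x] := abelian_type_pnat pG cGG xG.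
have /= := allP (abelian_type_gt1 G) x xG; rewrite def_x pfactorK //.
by case: k {def_x}.
Qed.

Lemma sumn_typ G : p.-group G -> abelian G -> sumn (typ p G) = lg G.
Proof.
move=> pG cGG; rewrite -(prod_abelian_type cGG) /typ.
have := abelian_type_gt1 G; elim: (abelian_type G) => [|x s IHs] /=.
  by rewrite big_nil logn1.
case/andP=> x_gt1 s_gt1; rewrite big_cons lognM ?IHs ?(ltnW x_gt1) //.
by rewrite big_seq prodn_cond_gt0 // => y /(allP s_gt1) /ltnW.
Qed.

End AbelianPGroups.

Section QuotientType.

Variables (p : nat) (gT : finGroupType).
Hypothesis p_pr : prime p.
Implicit Types B Y : {group gT}.

Local Notation lg A := (logn p #|A|).

Lemma lg_Mho_quotient B Y m : p.-group B -> abelian B -> Y \subset B ->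
  lg ('Mho^m(B / Y)) + lg ('Mho^m(B) :&: Y) = lg ('Mho^m(B)).
Proof.
move=> pB cBB sYB; have nYB : B \subset 'N(Y) by rewrite sub_abelian_norm.
have sMB := Mho_sub m B.
rewrite /quotient -morphim_Mho // -[coset Y @* _]/('Mho^m(B) / Y).
rewrite -(card_isog (second_isog (subset_trans sMB nYB))) card_quotient; last first.
  by rewrite sub_abelian_norm ?subsetIr // (abelianS sMB).
by rewrite -lognM ?cardG_gt0 // mulnC setIC Lagrange ?subsetIr ?subsetIl.
Qed.

(** The bridge between tableaux and orders, obtained from p^m (B/Y) = p^m B / (p^m B :&: Y) at m and
    m+1 and written without subtraction. *)
Lemma conj_typ_quotient B Y m : p.-group B -> abelian B -> Y \subset B ->
  conj (typ p (B / Y)) m.+1 + lg ('Mho^m(B) :&: Y) + lg ('Mho^m.+1(B))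
    = lg ('Mho^m(B)) + lg ('Mho^m.+1(B) :&: Y).
Proof.
move=> pB cBB sYB; have := conj_typ p_pr m (quotient_pgroup Y pB) (quotient_abelian Y cBB).
have := lg_Mho_quotient m pB cBB sYB; have := lg_Mho_quotient m.+1 pB cBB sYB.
by move=> /=; lia.
Qed.

End QuotientType.

Lemma typ_isog p (aT rT : finGroupType) (G : {group aT}) (H : {group rT}) :
  G \isog H -> typ p G = typ p H.
Proof. by move=> isoGH; rewrite /typ (isog_abelian_type isoGH). Qed.

Lemma typ_isogP p (aT rT : finGroupType) (G : {group aT}) (H : {group rT}) :
    prime p -> p.-group G -> abelian G -> p.-group H -> abelian H ->
  typ p G = typ p H -> G \isog H.
Proof.
move=> p_pr pG cGG pH cHH eqt; rewrite eq_abelian_type_isog //; apply/eqP.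
have K gT (K : {group gT}) : p.-group K -> abelian K ->
    abelian_type K = [seq (p ^ k)%N | k <- typ p K].
  move=> pK cKK; rewrite -map_comp -[LHS]map_id; apply/eq_in_map => x xK /=.
  by have /p_natP[k ->] := abelian_type_pnat pK cKK xK; rewrite pfactorK.
by rewrite !K // eqt.
Qed.

(** * The model group M(beta) *)

Section ModelGroup.

Variable p : nat.
Hypothesis p_pr : prime p.

Lemma Mty_cons k l (m : nat) :
  #|'Mho^m([set: Mty p (k :: l)])| = (p ^ (k - m) * #|'Mho^m([set: Mty p l])|)%N.
Proof.
have -> : [set: Mty p (k :: l)] = setX [set: 'I_(p ^ k).-1.+1] [set: Mty p l].
  by apply/setP=> x; rewrite !inE.
have := Mho_dprod m (setX_dprod [set: 'I_(p ^ k).-1.+1] [set: Mty p l]).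
move/dprod_card <-; congr (_ * _)%N; last first.
  by apply/esym/card_isog/isog_Mho/isog_set1X.
rewrite -(card_isog (isog_Mho m (isog_setX1 _ _))).
have ox : #[Zp1 : 'I_(p ^ k).-1.+1] = (p ^ k)%N.
  by rewrite orderE -Zp_cycle cardsT card_ord prednK // expn_gt0 prime_gt0.
rewrite /= Zp_cycle (@Mho_p_cycle _ _ p); last by rewrite /p_elt ox pnatX pnat_id.
by rewrite -orderE (orderXexp _ ox).
Qed.

Lemma Mty_pgroup l : p.-group [set: Mty p l].
Proof.
rewrite /pgroup -(Mho0 [set: Mty p l]); elim: l => [|k l IHl].
  by rewrite Mho0 cardsT card_ord.
by rewrite Mty_cons pnatM IHl pnatX pnat_id.
Qed.

Lemma Mty_abelian l : abelian [set: Mty p l].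
Proof.
apply/centsP=> x _ y _; elim: l x y => [|k l IHl] x y.
  by rewrite (ord1 x) (ord1 y).
case: x y => [x1 x2] [y1 y2]; congr (_, _); last exact: IHl.
by rewrite /= /mulg /=; apply: Zp_addC.
Qed.

Lemma typ_Mty l : is_partition l -> typ p [set: Mty p l] = l.
Proof.
move=> pl; have pM := Mty_pgroup l; have cM := Mty_abelian l.
apply: eq_partition_conj => // [|m]; first exact: typ_partition.
have := conj_typ p_pr m pM cM.
(* With truncated subtraction, a summand k - n is the logarithm of the order of p^n Z/(p^k);
   consecutive values of the sum differ by the number of parts exceeding n. *)
have lgM n : logn p #|'Mho^n([set: Mty p l])| = \sum_(k <- l) (k - n).
  elim: {pl pM cM} l => [|k l IHl].
    rewrite big_nil; have := subset_leq_card (Mho_sub n [set: Mty p [::]]).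
    rewrite /= cardsT card_ord => le1.
    by case: #|_| le1 => [|[|]] //; rewrite ?logn0 ?logn1.
  rewrite big_cons Mty_cons lognM ?cardG_gt0 ?expn_gt0 ?prime_gt0 //.
  by rewrite pfactorK // IHl.
rewrite !lgM => eqm; have {eqm} : conj (typ p [set: Mty p l]) m.+1 + \sum_(k <- l) (k - m.+1)
  = conj l m.+1 + \sum_(k <- l) (k - m.+1); last by lia.
rewrite eqm {eqm pl lgM pM cM}; elim: l => [|k l IHl]; first by rewrite !big_nil.
by rewrite !big_cons conj_cons IHl; lia.
Qed.

End ModelGroup.

(** * Extending height-preserving partial isomorphisms *)

Section MhoAbelian.

Variables (p : nat) (gT : finGroupType).
Implicit Types G H : {group gT}.

Lemma MhoP n G x : p.-group G -> abelian G ->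
  reflect (exists2 y, y \in G & x = y ^+ (p ^ n)) (x \in 'Mho^n(G)).
Proof.
move=> pG cGG; rewrite (MhoEabelian _ pG cGG).
by apply: (iffP imsetP) => -[y Gy ->]; exists y.
Qed.

Lemma Mho1P G x : p.-group G -> abelian G ->
  reflect (exists2 y, y \in G & x = y ^+ p) (x \in 'Mho^1(G)).
Proof. by move=> pG cGG; apply: (iffP (MhoP 1 x pG cGG)); rewrite expn1. Qed.

Lemma Mho_expS n G x : p.-group G -> abelian G -> x \in 'Mho^n(G) -> x ^+ p \in 'Mho^n.+1(G).
Proof.
move=> pG cGG /(MhoP _ _ pG cGG)[y Gy ->]; apply/(MhoP _ _ pG cGG).
by exists y; rewrite // expnSr expgM.
Qed.

Lemma Mho_add m n G : p.-group G -> abelian G -> 'Mho^m('Mho^n(G)) = 'Mho^(m + n)(G).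
Proof.
move=> pG cGG; have sMG := Mho_sub n G.
have pM := pgroupS sMG pG; have cM := abelianS sMG cGG.
apply/setP=> x; apply/(MhoP _ _ pM cM)/(MhoP _ _ pG cGG) => [[_ /(MhoP _ _ pG cGG)[y Gy ->] ->]|].
  by exists y; rewrite // -expgM -expnD addnC.
case=> y Gy ->; exists (y ^+ (p ^ n)); last by rewrite -expgM -expnD addnC.
by apply/(MhoP _ _ pG cGG); exists y.
Qed.

Lemma Ohm1P G x : p.-group G -> abelian G -> (x \in 'Ohm_1(G)) = (x \in G) && (x ^+ p == 1).
Proof. by move=> pG cGG; rewrite (OhmEabelian pG (abelianS _ cGG)) ?Ohm_sub // !inE expn1. Qed.

Lemma Mho_eq1 n G : prime p -> p.-group G -> logn p #|G| <= n -> 'Mho^n(G) = 1.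
Proof.
move=> p_pr pG le; apply/trivgP; rewrite /= (MhoE n pG) gen_subG.
apply/subsetP=> _ /imsetP[x Gx ->]; rewrite inE -order_dvdn.
by rewrite (dvdn_trans (order_dvdG Gx)) // (card_pgroup pG) dvdn_exp2l.
Qed.

End MhoAbelian.

Section HeightPreserving.

Variables (p : nat) (gT : finGroupType) (B : {group gT}).
Hypotheses (p_pr : prime p) (pB : p.-group B) (cBB : abelian B).
Implicit Types Y Z : {group gT}.
Implicit Types F : {group (gT * gT)}.

(* A partial isomorphism between subgroups of B is handled through its graph F. *)
Definition height_preserving F :=
  forall k x y, (x, y) \in F -> (x \in 'Mho^k(B)) = (y \in 'Mho^k(B)).

Definition gdom F := [set u.1 | u in F].
Definition gcod F := [set u.2 | u in F].

Lemma gdomP F x : reflect (exists y, (x, y) \in F) (x \in gdom F).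
Proof.
by apply: (iffP imsetP) => [[[x1 y] Fu /= ->]|[y Fu]]; [exists y | exists (x, y)].
Qed.

Lemma gcodP F y : reflect (exists x, (x, y) \in F) (y \in gcod F).
Proof.
by apply: (iffP imsetP) => [[[x y1] Fu /= ->]|[x Fu]]; [exists x | exists (x, y)].
Qed.

Lemma gdomM F x y : x \in gdom F -> y \in gdom F -> x * y \in gdom F.
Proof. by move=> /gdomP[x1 F1] /gdomP[x2 F2]; apply/gdomP; exists (x1 * x2); apply: (groupM F1 F2). Qed.

Lemma gcodM F x y : x \in gcod F -> y \in gcod F -> x * y \in gcod F.
Proof. by move=> /gcodP[x1 F1] /gcodP[x2 F2]; apply/gcodP; exists (x1 * x2); apply: (groupM F1 F2). Qed.

Lemma graphV F x y : (x, y) \in F -> (x^-1, y^-1) \in F.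
Proof. by move=> Fu; apply: (groupVr Fu). Qed.

Lemma pairX (x y : gT) n : (x, y) ^+ n = (x ^+ n, y ^+ n).
Proof. by elim: n => // n IHn; rewrite !expgS IHn. Qed.

Lemma graphX F x y n : (x, y) \in F -> (x ^+ n, y ^+ n) \in F.
Proof. by move=> Fu; rewrite -pairX groupX. Qed.

Lemma graph1 F : (1, 1) \in F.
Proof. exact: (group1 F). Qed.

Lemma gdomV F x : (x^-1 \in gdom F) = (x \in gdom F).
Proof.
suff imp y : y \in gdom F -> y^-1 \in gdom F by apply/idP/idP=> /imp; rewrite ?invgK.
by case/gdomP=> z /graphV Fz; apply/gdomP; exists z^-1.
Qed.

Lemma gcodV F x : (x^-1 \in gcod F) = (x \in gcod F).
Proof.
suff imp y : y \in gcod F -> y^-1 \in gcod F by apply/idP/idP=> /imp; rewrite ?invgK.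
by case/gcodP=> z /graphV Fz; apply/gcodP; exists z^-1.
Qed.

(** Being 1 is itself a height condition, since p^N B = 1 for N the logarithm of |B|. Hence a
    height-preserving F is the graph of an isomorphism from [gdom F] onto [gcod F]. *)
Lemma hp_eq1 F x y : height_preserving F -> (x, y) \in F -> (x == 1) = (y == 1).
Proof.
move=> hpF Fu; have := hpF (logn p #|B|) x y Fu.
by rewrite (Mho_eq1 p_pr pB) // !inE.
Qed.

Lemma hp_inj F x y x' y' : height_preserving F -> (x, y) \in F -> (x', y') \in F ->
  (x == x') = (y == y').
Proof.
move=> hpF Fu /graphV Fv; rewrite eq_mulgV1 [RHS]eq_mulgV1.
exact: hp_eq1 hpF (groupM Fu Fv).
Qed.

Lemma card_hp F (Z Z' : {set gT}) : height_preserving F ->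
    (forall x y, (x, y) \in F -> (x \in Z) = (y \in Z')) ->
  #|gdom F :&: Z| = #|gcod F :&: Z'|.
Proof.
move=> hpF ZZ'; pose S := [set u in F | u.1 \in Z].
have <- : [set u.1 | u in S] = gdom F :&: Z.
  apply/setP=> x; rewrite inE; apply/imsetP/andP=> [[[x1 y]]|[/gdomP[y Fu] Zx]].
    by rewrite inE /= => /andP[Fu Zx] ->; split=> //; apply/gdomP; exists y.
  by exists (x, y); rewrite // inE Fu.
have <- : [set u.2 | u in S] = gcod F :&: Z'.
  apply/setP=> y; rewrite inE; apply/imsetP/andP=> [[[x y1]]|[/gcodP[x Fu] Zx]].
    by rewrite inE /= => /andP[Fu Zx] ->; split; [apply/gcodP; exists x | rewrite -(ZZ' _ _ Fu)].
  by exists (x, y); rewrite // inE Fu /= (ZZ' _ _ Fu).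
rewrite !card_in_imset // => -[x y] [x' y']; rewrite !inE /= => /andP[Fu _] /andP[Fv _] e;
  have := hp_inj hpF Fu Fv; rewrite e eqxx.
  by move/eqP->.
by move/esym/eqP->.
Qed.

Lemma pexp_inv i : 0 < i < p -> exists j t, (i * j = t * p + 1)%N.
Proof.
case/andP=> i_gt0 ltip; case: (egcdnP p i_gt0) => j t def_j _; exists j, t.
by rewrite mulnC def_j; congr (_ + _); apply/eqP; rewrite -/(coprime i p) coprime_sym prime_coprime // gtnNdvd.
Qed.

(** The last two hypotheses say that g and g' have maximal height n in their cosets. For 0 < i < p,
    the element x g^i then lies in p^k B exactly when x does if k <= n, and never if k > n; the same
    holds on the other side. *)
Lemma hp_extend F n g g' :
    F \subset setX B B -> height_preserving F -> g \in 'Mho^n(B) -> g' \in 'Mho^n(B) ->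
    (g ^+ p, g' ^+ p) \in F ->
    (forall x, x \in gdom F -> x * g \notin 'Mho^n.+1(B)) ->
    (forall y, y \in gcod F -> y * g' \notin 'Mho^n.+1(B)) ->
  height_preserving (F <*> <[(g, g')]>).
Proof.
move=> sFB hpF Mg Mg' Fgp prop_g prop_g' k x y.
have Bg := subsetP (Mho_sub n B) _ Mg; have Bg' := subsetP (Mho_sub n B) _ Mg'.
have cBB2 : abelian (setX B B).
  apply/centsP=> -[x1 y1] /setXP[/= Bx1 By1] [x2 y2] /setXP[/= Bx2 By2].
  by congr (_, _); apply: (centsP cBB).
have sgB : <[(g, g')]> \subset setX B B by rewrite cycle_subG inE /= Bg.
rewrite /= cent_joinEr; last exact: sub_abelian_cent2 cBB2 sgB sFB.
(* The multiple of p in the exponent i is absorbed into F through (g^p, g'^p), leaving an exponent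
   below p. *)
case/mulsgP=> -[x0 y0] _ F0 /cycleP[i ->]; rewrite pairX (divn_eq i p).
rewrite !expgD mulnC !expgM; have := graphX (i %/ p) Fgp.
set x1 := (g ^+ p) ^+ _; set y1 := (g' ^+ p) ^+ _ => F1 [-> ->].
have := groupM F0 F1 => {F1}.
rewrite -!/(_ * _)%g /= => F01; rewrite !mulgA.
have {F0} : (x0 * x1, y0 * y1) \in F by [].
move: (x0 * x1) (y0 * y1) => {x0 y0 x1 y1 F01} {}x {}y Fxy.
have : i %% p < p by rewrite ltn_mod prime_gt0.
case: (i %% p) => [|{}i] ltip; first by rewrite !expg0 !mulg1 (hpF k _ _ Fxy).
have [lekn | ltnk] := leqP k n.
  have sk := subsetP (Mho_leq B lekn).
  have gk : g ^+ i.+1 \in 'Mho^k(B) by rewrite sk ?groupX.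
  have gk' : g' ^+ i.+1 \in 'Mho^k(B) by rewrite sk ?groupX.
  by rewrite (groupMr _ gk) (groupMr _ gk') (hpF k _ _ Fxy).
(* Raising to the inverse j of the exponent modulo p turns x g^(i+1) into an element of the domain
   times g, so membership in p^(n+1) B would contradict maximality. *)
have [j [t def_j]] : exists j t, (i.+1 * j = t * p + 1)%N by apply: pexp_inv.
have sub_k := subsetP (Mho_leq B ltnk).
have [/subsetP sd /subsetP sc] : gdom F \subset B /\ gcod F \subset B.
  by split; apply/subsetP=> z; [case/gdomP | case/gcodP] => w /(subsetP sFB) /setXP[].
have dx : x \in gdom F by apply/gdomP; exists y.
have cy : y \in gcod F by apply/gcodP; exists x.
have expE (h z : gT) : h \in B -> z \in B ->
    (z * h ^+ i.+1) ^+ j = z ^+ j * (h ^+ p) ^+ t * h.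
  move=> Bh Bz; rewrite expgMn; last by apply: (centsP cBB); rewrite ?groupX.
  by rewrite -expgM def_j expgD expg1 mulgA mulnC expgM.
transitivity false; [apply/negP | apply/esym/negP] => /sub_k /(groupX j).
  rewrite (expE _ _ Bg (sd _ dx)); apply/negP/prop_g.
  apply/gdomP; exists (y ^+ j * (g' ^+ p) ^+ t).
  exact: groupM (graphX j Fxy) (graphX t Fgp).
rewrite (expE _ _ Bg' (sc _ cy)); apply/negP/prop_g'.
apply/gcodP; exists (x ^+ j * (g ^+ p) ^+ t).
exact: groupM (graphX j Fxy) (graphX t Fgp).
Qed.

(* Extending at an element of maximal height outside the domain makes the properness
   conditions of [hp_extend] automatic. *)
Lemma hp_extend_max Y Y' F :
    Y \subset B -> Y' \subset B -> F \subset setX Y Y' -> height_preserving F ->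
    (forall n, #|Y :&: 'Mho^n(B)| = #|Y' :&: 'Mho^n(B)|) ->
    (forall (F1 : {group gT * gT}) n g, F \subset F1 -> F1 \subset setX Y Y' ->
        height_preserving F1 ->
        g \in Y :&: 'Mho^n(B) -> g \notin gdom F1 ->
        Y :&: 'Mho^n.+1(B) \subset gdom F1 ->
      exists g0 g', [/\ g0 \in Y :&: 'Mho^n(B), g0 \notin gdom F1,
        g' \in Y' :&: 'Mho^n(B), g' \notin gcod F1 & (g0 ^+ p, g' ^+ p) \in F1]) ->
  exists F2 : {group gT * gT}, [/\ F \subset F2, height_preserving F2,
    gdom F2 = Y & gcod F2 = Y'].
Proof.
move=> sYB sYB' sFY hpF eqYY' step.
have [N leN] := ubnP (#|setX Y Y'| - #|F|); elim: N F leN sFY hpF step => // N IHN F leN sFY hpF step.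
have sFB : F \subset setX B B by rewrite (subset_trans sFY) ?setXS.
have sdY : gdom F \subset Y by apply/subsetP=> x /gdomP[y /(subsetP sFY) /setXP[]].
have scY : gcod F \subset Y' by apply/subsetP=> x /gcodP[y /(subsetP sFY) /setXP[]].
have card_Mho n : #|gdom F :&: 'Mho^n(B)| = #|gcod F :&: 'Mho^n(B)|.
  by apply: card_hp => // x y; apply: hpF.
have [sYd | /subsetPn[g0 Yg0 dg0]] := boolP (Y \subset gdom F).
  exists F; have dY : gdom F = Y by apply/eqP; rewrite eqEsubset sdY.
  split=> //; apply/eqP; rewrite eqEcard scY /=.
  have := card_Mho 0; rewrite Mho0 dY (setIidPl sYB) (setIidPl (subset_trans scY sYB')) => <-.
  by have := eqYY' 0; rewrite Mho0 (setIidPl sYB) (setIidPl sYB') => ->.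
have exn : exists n, Y :&: 'Mho^n(B) \subset gdom F.
  exists (logn p #|B|); rewrite (Mho_eq1 p_pr pB) //.
  by apply/subsetP=> x /setIP[_ /set1P->]; apply/gdomP; exists 1; apply: graph1.
(* By minimality, Y :&: p^(n+1) B lies in the domain and some g in Y :&: p^n B does not; this g has
   the largest height available outside the domain. *)
case: (ex_minnP exn) => -[|n] sYn minn.
  by case/negP: dg0; rewrite (subsetP sYn) // Mho0 inE Yg0 (subsetP sYB).
have /subsetPn[g Yg dg] : ~~ (Y :&: 'Mho^n(B) \subset gdom F).
  by apply/negP=> /minn; rewrite ltnn.
have [g1 [g' [Yg1 dg1 Yg' cg' Fgp]]] := step F n g (subxx _) sFY hpF Yg dg sYn.
(* The same inclusion for the codomain follows by counting: F matches the elements of p^(n+1) B on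
   both sides, and Y and Y' contain equally many of them. *)
have sYn' : Y' :&: 'Mho^n.+1(B) \subset gcod F.
  have eqc : gcod F :&: 'Mho^n.+1(B) = Y' :&: 'Mho^n.+1(B).
    apply/eqP; rewrite eqEcard setSI // -card_Mho -eqYY' subset_leq_card //.
    by rewrite subsetI sYn subsetIr.
  by rewrite -eqc subsetIl.
have [{}Yg1 Mg1] := setIP Yg1; have [{}Yg' Mg'] := setIP Yg'.
pose F1 := (F <*> <[(g1, g')]>)%G.
have sFF1 : F \subset F1 by apply: joing_subl.
have F1g : (g1, g') \in F1 by rewrite (subsetP (joing_subr _ _)) ?cycle_id.
have sF1Y : F1 \subset setX Y Y' by rewrite join_subG sFY cycle_subG inE /= Yg1.
have hpF1 : height_preserving F1.
  apply: (@hp_extend F n g1 g') => // [x dx | y cy]; apply/negP=> M1.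
    case/negP: dg1; rewrite -(mulKg x g1) gdomM ?gdomV //.
    by rewrite (subsetP sYn) // inE M1 groupM // (subsetP sdY).
  case/negP: cg'; rewrite -(mulKg y g') gcodM ?gcodV //.
  by rewrite (subsetP sYn') // inE M1 groupM // (subsetP scY).
have ltF : #|F| < #|F1|.
  rewrite proper_card // properE sFF1 /=; apply: contra dg1 => /subsetP/(_ _ F1g) Fg.
  by apply/gdomP; exists g'.
have [|F2 n2 g2 sF1F2|F2 [sF1F2 hpF2 dF2 cF2]] := IHN F1 _ sF1Y hpF1.
- have ltF' := ltn_sub2l (leq_trans ltF (subset_leq_card sF1Y)) ltF.
  exact: leq_trans ltF' leN.
- exact: step (subset_trans sFF1 sF1F2).
by exists F2; split=> //; apply: subset_trans sF1F2.
Qed.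

(** F puts [gdom F :&: Z] in bijection with [gcod F :&: Z']. If Y :&: Z and Y' :&: Z' have the same
    order and F misses an element of the first, it must miss one of the second. *)
Lemma card_ltn_exists F Y Y' (Z Z' : {set gT}) g :
    height_preserving F -> (forall x y, (x, y) \in F -> (x \in Z) = (y \in Z')) ->
    gdom F :&: Z \subset Y -> #|Y :&: Z| = #|Y' :&: Z'| -> g \in Y :&: Z -> g \notin gdom F ->
  exists2 g', g' \in Y' :&: Z' & g' \notin gcod F.
Proof.
move=> hpF ZZ' sdY eqYY' Yg dg; apply/subsetPn; apply: contra dg => sYc.
have : gdom F :&: Z = Y :&: Z.
  apply/eqP; rewrite eqEcard subsetI sdY subsetIr (card_hp hpF ZZ') eqYY'.
  by rewrite subset_leq_card // subsetI sYc subsetIr.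
by move/setP/(_ g); rewrite Yg => /setIP[].
Qed.

(** All p-th powers are 1, so an image of g only has to have the right height and lie outside the
    codomain; [card_ltn_exists] supplies it. *)
Lemma hp_extend_elem Y Y' F :
    Y \subset B -> Y' \subset B -> F \subset setX Y Y' -> height_preserving F ->
    (forall n, #|Y :&: 'Mho^n(B)| = #|Y' :&: 'Mho^n(B)|) ->
    {in Y, forall x, x ^+ p = 1} -> {in Y', forall x, x ^+ p = 1} ->
  exists F2 : {group gT * gT}, [/\ F \subset F2, height_preserving F2,
    gdom F2 = Y & gcod F2 = Y'].
Proof.
move=> sYB sYB' sFY hpF eqYY' eY eY'; apply: hp_extend_max => // F1 n g _ sF1Y hpF1 Yg dg _.
have [x y /(hpF1 n)||g' Yg' cg'] // := card_ltn_exists hpF1 _ _ (eqYY' n) Yg dg.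
  by apply: subset_trans (subsetIl _ _) _; apply/subsetP=> x /gdomP[y /(subsetP sF1Y)/setXP[]].
exists g, g'; split=> //; rewrite eY ?eY' ?graph1 //; first by case/setIP: Yg'.
by case/setIP: Yg.
Qed.

(** An extension of F1 is still injective, so no new pair can have just one of its entries in Z or
    Z', which F1 already covers. *)
Lemma hp_agree F1 F2 (Z Z' : {set gT}) :
    F1 \subset F2 -> height_preserving F2 -> Z \subset gdom F1 -> Z' \subset gcod F1 ->
    (forall x y, (x, y) \in F1 -> (x \in Z) = (y \in Z')) ->
  forall x y, (x, y) \in F2 -> (x \in Z) = (y \in Z').
Proof.
move=> sF hpF2 sZ sZ' ZZ' x y Fu; apply/idP/idP=> [Zx | Zy].
  have [y1 Fv] := gdomP _ _ (subsetP sZ x Zx); have := hp_inj hpF2 Fu (subsetP sF _ Fv).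
  by rewrite eqxx => /esym/eqP->; rewrite -(ZZ' _ _ Fv).
have [x1 Fv] := gcodP _ _ (subsetP sZ' y Zy); have := hp_inj hpF2 Fu (subsetP sF _ Fv).
by rewrite eqxx => /eqP->; rewrite (ZZ' _ _ Fv).
Qed.

End HeightPreserving.

(** * From equal orders to an automorphism of B *)

Section Transitivity.

Variables (p : nat) (gT : finGroupType) (B : {group gT}).
Hypotheses (p_pr : prime p) (pB : p.-group B) (cBB : abelian B).
Implicit Types X : {group gT}.
Implicit Types F : {group (gT * gT)}.

Lemma aut_of_graph F : height_preserving B F -> gdom F = B -> gcod F = B ->
  exists2 a, a \in Aut B & forall x y, (x, y) \in F -> a x = y.
Proof.
move=> hpF dF cF; pose f x := odflt 1 [pick y | (x, y) \in F].
have fP x : x \in B -> (x, f x) \in F.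
  rewrite -{1}dF => /gdomP[y Fxy]; rewrite /f; case: pickP => [//|/(_ y)].
  by rewrite Fxy.
have fE x y : (x, y) \in F -> f x = y.
  move=> Fxy; have Bx : x \in B by rewrite -dF; apply/gdomP; exists y.
  by have := hp_inj p_pr pB hpF (fP x Bx) Fxy; rewrite eqxx => /esym/eqP.
have fM : {in B &, {morph f : x y / x * y}}.
  by move=> x y Bx By; apply: fE; apply: (groupM (fP x Bx) (fP y By)).
pose fm := Morphism fM.
have injf : 'injm fm.
  apply/injmP=> x y Bx By /= /eqP; rewrite -(hp_inj p_pr pB hpF (fP x Bx) (fP y By)).
  by move/eqP.
have imf : fm @* B = B.
  apply/eqP; rewrite eqEcard card_injm ?leqnn ?andbT //.
  apply/subsetP=> _ /morphimP[x _ Bx ->] /=; rewrite -cF.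
  by apply/gcodP; exists x; apply: fP.
exists (aut injf imf); first exact: Aut_aut.
move=> x y Fxy; have Bx : x \in B by rewrite -dF; apply/gdomP; exists y.
by rewrite autE //= (fE _ _ Fxy).
Qed.

Local Notation M n := 'Mho^n(B).

(** Because p^(n+1) B = p(p^n B), the image of g^p always has a p-th root y' in p^n B, which is the
    candidate image of g. *)
Lemma abelian_embedding_extend X X' F :
    X \subset B -> X' \subset B -> height_preserving B F -> gdom F = X -> gcod F = X' ->
    F \subset setX X X' ->
  exists2 a, a \in Aut B & a @: X = X'.
Proof.
move=> sXB sXB' hpF dF cF sFX.
have sFB : F \subset setX B B by apply: subset_trans sFX (setXS sXB sXB').
have [F1 n g sF1 sF1B hpF1|F2 [sF2 hpF2 dF2 cF2]] :=
    @hp_extend_max _ _ _ p_pr pB cBB B B F (subxx _) (subxx _) sFB hpF (fun=> erefl).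
  rewrite (setIidPr (Mho_sub _ _)) => Mg dg; rewrite (setIidPr (Mho_sub _ _)) => sMd.
  have Mgp := Mho_expS pB cBB Mg.
  have [z Fz] := gdomP _ _ (subsetP sMd _ Mgp).
  have [y' My' def_z] : exists2 y', y' \in M n & z = y' ^+ p.
    have : z \in M n.+1 by rewrite -(hpF1 _ _ _ Fz).
    rewrite /= -add1n -(Mho_add _ _ pB cBB) => Mz.
    have [pM cM] := (pgroupS (Mho_sub n B) pB, abelianS (Mho_sub n B) cBB).
    by have [y My ->] := Mho1P z pM cM Mz; exists y.
  have [cy' | cy'] := boolP (y' \in gcod F1); last first.
    by exists g, y'; split; rewrite -?def_z.
  (* If y' is already the image of some s, then s^p = g^p. Replacing g by s^-1 g, still of height at
     least n and outside the domain but killed by p, leaves only a matching by order p and height,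
     done by counting in B. *)
  have [s Fs] := gcodP _ _ cy'.
  have Ms : s \in M n by rewrite (hpF1 _ _ _ Fs).
  have /eqP sp : s ^+ p == g ^+ p.
    by rewrite (hp_inj p_pr pB hpF1 (graphX p Fs) Fz) def_z.
  have Bs := subsetP (Mho_sub _ _) _ Ms; have Bg := subsetP (Mho_sub _ _) _ Mg.
  pose Z := M n :&: [set x | x ^+ p == 1].
  have Fp x y : (x, y) \in F1 -> (x \in Z) = (y \in Z).
    by move=> Fxy; rewrite !inE (hpF1 _ _ _ Fxy) (hp_eq1 p_pr pB hpF1 (graphX p Fxy)).
  have h1 : (s^-1 * g) ^+ p = 1.
    by rewrite expgMn ?expgVn ?sp ?mulVg //; apply: (centsP cBB); rewrite ?groupV.
  have Zh : s^-1 * g \in B :&: Z.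
    by rewrite !inE h1 eqxx andbT !groupM ?groupV.
  have dh : s^-1 * g \notin gdom F1.
    apply: contra dg => dh; rewrite -(mulKVg s g); apply: gdomM => //.
    by apply/gdomP; exists y'.
  have sdB : gdom F1 :&: Z \subset B.
    by apply: subset_trans (subsetIr _ _) (subset_trans (subsetIl _ _) (Mho_sub _ _)).
  have [h' Zh' ch'] := card_ltn_exists p_pr pB hpF1 Fp sdB (erefl _) Zh dh.
  exists (s^-1 * g), h'; move: Zh'; rewrite !inE => /and3P[_ Mh' /eqP ->].
  by rewrite h1 graph1; split=> //; rewrite groupM ?groupV.
have [a autA aE] := aut_of_graph hpF2 dF2 cF2; exists a => //.
apply/setP=> y; apply/imsetP/idP=> [[x Xx ->] | Xy].
  rewrite -dF in Xx; have [y1 Fxy] := gdomP _ _ Xx.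
  by rewrite (aE _ _ (subsetP sF2 _ Fxy)) -cF; apply/gcodP; exists x.
rewrite -cF in Xy; have [x Fxy] := gcodP _ _ Xy.
by exists x; rewrite ?(aE _ _ (subsetP sF2 _ Fxy)) // -dF; apply/gdomP; exists y.
Qed.

(* An isomorphism is built first on pX, following its filtration by the
   p (X :&: p^r B) for decreasing r, then on the elements of order p of X, then on X,
   and finally on B. *)
Theorem square_bounded_transitive X X' :
    X \subset B -> X' \subset B -> 'Mho^2(X) = 1 -> 'Mho^2(X') = 1 ->
    (forall m, #|X :&: M m| = #|X' :&: M m|) ->
    (forall r m, #|'Mho^1(X :&: M r) :&: M m| = #|'Mho^1(X' :&: M r) :&: M m|) ->
  exists2 a, a \in Aut B & a @: X = X'.
Proof.
move=> sXB sXB' X2 X2' eqX eqU.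
pose U (Y : {group gT}) r := 'Mho^1(Y :&: M r)%G.
have UP (Y : {group gT}) r x : Y \subset B ->
    reflect (exists2 y, (y \in Y) && (y \in M r) & x = y ^+ p) (x \in U Y r).
  move=> sYB; have sYM : Y :&: M r \subset B by apply: subset_trans sYB; apply: subsetIl.
  apply: (iffP (Mho1P x (pgroupS sYM pB) (abelianS sYM cBB))) => -[y Yy ->].
    by exists y => //; case/setIP: Yy => -> ->.
  by exists y; rewrite // inE.
have UY (Y : {group gT}) r : Y \subset B -> U Y r \subset Y.
  by move=> sYB; apply: (subset_trans (Mho_sub 1 (Y :&: M r)%G)); apply: subsetIl.
have Y1 (Y : {group gT}) x : Y \subset B -> 'Mho^2(Y) = 1 -> x \in Y -> x ^+ p ^+ p = 1.
  move=> sYB Y2 Yx; have pY := pgroupS sYB pB; have cY := abelianS sYB cBB.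
  have : x ^+ (p ^ 2) \in 'Mho^2(Y) by apply/(MhoP _ _ pY cY); exists x.
  by rewrite Y2 => /set1P; rewrite -mulnn expgM.
have U1 (Y : {group gT}) r x : Y \subset B -> 'Mho^2(Y) = 1 -> x \in U Y r -> x ^+ p = 1.
  by move=> sYB Y2 /(UP _ _ _ sYB)[y /andP[Yy _] ->]; apply: Y1 Yy.
have leU (Y : {group gT}) r s : r <= s -> U Y s \subset U Y r.
  by move=> lers; rewrite MhoS // setIS ?Mho_leq.
(* In the filtration that follows, the matching of p(X :&: p^s B) with p(X' :&: p^s B) is carried
   along at each stage. It later guarantees that the image of g^p, for g in X :&: p^n B, has a p-th
   root in X' :&: p^n B. *)
have [N MN] : exists N, M N = 1 by exists (logn p #|B|); apply: (Mho_eq1 p_pr pB).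
have stage1 r : r <= N -> exists F, [/\ F \subset setX (U X (N - r)) (U X' (N - r)),
    height_preserving B F, gdom F = U X (N - r), gcod F = U X' (N - r) &
    forall s x y, N - r <= s -> (x, y) \in F -> (x \in U X s) = (y \in U X' s)].
  elim: r => [_|r IHr ltrN].
    have UN Y : U Y N = 1%G.
      apply/trivGP; apply: subset_trans (Mho_sub _ _) _.
      by rewrite /= MN subsetIr.
    exists 1%G; rewrite subn0 !UN; split.
    - by apply/subsetP=> _ /set1P->; apply: group1.
    - by move=> k x y /set1P[-> ->]; rewrite !group1.
    - by rewrite /gdom imset_set1.
    - by rewrite /gcod imset_set1.
    by move=> s x y _ /set1P[-> ->]; rewrite !group1.
  have [F [sFU hpF dF cF FU]] := IHr (ltnW ltrN).
  set t := N - r.+1; have def_t : N - r = t.+1 by rewrite /t; lia.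
  rewrite def_t in sFU dF cF FU.
  have sFt : F \subset setX (U X t) (U X' t).
    by apply: subset_trans sFU _; rewrite setXS ?leU.
  have [||n|x|x|F2 [sF2 hpF2 dF2 cF2]] := hp_extend_elem p_pr pB cBB _ _ sFt hpF.
  - exact: subset_trans (UY _ _ sXB) sXB.
  - exact: subset_trans (UY _ _ sXB') sXB'.
  - exact: eqU.
  - exact: U1.
  - exact: U1.
  exists F2; split=> //.
    apply/subsetP=> -[x y] Fxy; rewrite inE -dF2 -cF2.
    by apply/andP; split; [apply/gdomP; exists y | apply/gcodP; exists x].
  move=> s x y; rewrite leq_eqVlt => /predU1P[<- | lts] Fxy.
    rewrite -dF2 -cF2; transitivity true; first by apply/gdomP; exists y.
    by apply/esym/gcodP; exists x.
  apply: (hp_agree p_pr pB sF2 hpF2 _ _ _ Fxy); rewrite ?dF ?cF ?leU // => x1 y1.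
  exact: FU.
have [F0 []] := stage1 N (leqnn N); rewrite subnn => sF0 hpF0 dF0 cF0 FU0.
have pX := pgroupS sXB pB; have cX := abelianS sXB cBB.
have pX' := pgroupS sXB' pB; have cX' := abelianS sXB' cBB.
have sF0O : F0 \subset setX 'Ohm_1(X) 'Ohm_1(X').
  apply: subset_trans sF0 (setXS _ _); apply/subsetP=> x Ux; rewrite (@Ohm1P p) //.
    by rewrite (subsetP (UY _ _ sXB) _ Ux) (U1 _ _ _ sXB X2 Ux) eqxx.
  by rewrite (subsetP (UY _ _ sXB') _ Ux) (U1 _ _ _ sXB' X2' Ux) eqxx.
(* The p-th power map on Y :&: p^m B has kernel ['Ohm_1(Y) :&: M m], so the two given families of
   orders determine the orders for the elements killed by p. The factor [M 0] is B, kept to match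
   [eqU]. *)
have cardO (Y : {group gT}) m : Y \subset B ->
    (#|'Ohm_1(Y) :&: M m| * #|'Mho^1(Y :&: M m) :&: M 0| = #|Y :&: M m|)%N.
  move=> sYB; have sYM : Y :&: M m \subset Y := subsetIl _ _.
  have pY := pgroupS sYB pB; have cY := abelianS sYB cBB.
  have -> : 'Ohm_1(Y) :&: M m = 'Ohm_1(Y :&: M m).
    apply/setP=> x; rewrite inE (@Ohm1P p _ Y) // (@Ohm1P p _ (Y :&: M m)) ?inE.
    - by rewrite andbAC.
    - exact: pgroupS pY.
    exact: abelianS cY.
  have sMB : 'Mho^1(Y :&: M m) \subset B := subset_trans (Mho_sub 1 _) (subset_trans sYM sYB).
  rewrite Mho0 (setIidPl sMB).
  exact: mul_card_Ohm_Mho_abelian (abelianS sYM cY).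
have [||m|x|x|F1 [sF01 hpF1 dF1 cF1]] := hp_extend_elem p_pr pB cBB _ _ sF0O hpF0.
- exact: subset_trans (Ohm_sub _ _) sXB.
- exact: subset_trans (Ohm_sub _ _) sXB'.
- apply/eqP; rewrite -(eqn_pmul2r (cardG_gt0 ('Mho^1(X :&: M m) :&: M 0))) /=.
  by rewrite {2}eqU !cardO // eqX.
- by rewrite (@Ohm1P p) // => /andP[_ /eqP].
- by rewrite (@Ohm1P p) // => /andP[_ /eqP].
have sF1X : F1 \subset setX X X'.
  apply/subsetP=> -[x y] Fxy; rewrite inE (subsetP (Ohm_sub 1 X)) ?(subsetP (Ohm_sub 1 X')) //=.
    by rewrite -cF1; apply/gcodP; exists x.
  by rewrite -dF1; apply/gdomP; exists y.
have FU1 s x y : (x, y) \in F1 -> (x \in U X s) = (y \in U X' s).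
  move=> Fxy; apply: (hp_agree p_pr pB sF01 hpF1 _ _ _ Fxy); rewrite ?dF0 ?cF0 ?leU // => x1 y1.
  exact: FU0.
have [n|F2 n g sF12 sF2X hpF2 /setIP[Xg Mg] dg _|F2 [sF12 hpF2 dF2 cF2]] :=
   hp_extend_max p_pr pB cBB sXB sXB' sF1X hpF1.
- exact: eqX.
- have Ugp : g ^+ p \in U X n by apply/UP => //; exists g; rewrite ?Xg.
  have : g ^+ p \in gdom F1.
    by rewrite dF1 (@Ohm1P p) ?groupX // (U1 X n) ?eqxx.
  case/gdomP=> z Fz; have := Ugp; rewrite (FU1 _ _ _ Fz) => /(UP _ _ _ sXB')[g' /andP[Xg' Mg'] def_z].
  exists g, g'; split; rewrite ?inE ?Xg ?Xg' //; last by rewrite -def_z (subsetP sF12).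
  (* If g' were the image of s, then s^-1 g would be killed by p and so already lie in the domain of
     F1, which would put g in the domain too. *)
  apply: contra dg => /gcodP[s Fs].
  have /eqP sp : s ^+ p == g ^+ p.
    by rewrite (hp_inj p_pr pB hpF2 (graphX p Fs) (subsetP sF12 _ Fz)) def_z.
  have Xs : s \in X by have := subsetP sF2X _ Fs => /setXP[].
  have : s^-1 * g \in gdom F1.
    rewrite dF1 (@Ohm1P p) // groupM ?groupV //= expgMn ?expgVn ?sp ?mulVg ?eqxx //.
    by apply: (centsP cX); rewrite ?groupV.
  case/gdomP=> w Fw; rewrite -(mulKVg s g); apply: gdomM; apply/gdomP; [exists g' | exists w] => //.
  exact: (subsetP sF12).
apply: (abelian_embedding_extend sXB sXB' hpF2 dF2 cF2).
apply/subsetP=> -[x y] Fxy; rewrite inE -dF2 -cF2.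
by apply/andP; split; [apply/gdomP; exists y | apply/gcodP; exists x].
Qed.

End Transitivity.

(** * Orbits of embeddings with a given tableau *)

(** Descending induction on m: the intersection is trivial once p^m B = 1, and [conj_typ_quotient]
    passes from m+1 to m. *)
Lemma eq_conj_card p (gT : finGroupType) (B Y Y' : {group gT}) :
    prime p -> p.-group B -> abelian B -> Y \subset B -> Y' \subset B ->
    (forall m, conj (typ p (B / Y)) m.+1 = conj (typ p (B / Y')) m.+1) ->
  forall m, #|Y :&: 'Mho^m(B)| = #|Y' :&: 'Mho^m(B)|.
Proof.
move=> p_pr pB cBB sYB sYB' eqc m.
suff eql : logn p #|'Mho^m(B) :&: Y| = logn p #|'Mho^m(B) :&: Y'|.
  have pI (Z : {group gT}) : p.-group ('Mho^m(B) :&: Z).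
    by apply: pgroupS pB; apply: subset_trans (subsetIl _ _) (Mho_sub _ _).
  by rewrite setIC [in RHS]setIC (card_pgroup (pI Y)) (card_pgroup (pI Y')) eql.
have step n : logn p #|'Mho^n.+1(B) :&: Y| = logn p #|'Mho^n.+1(B) :&: Y'| ->
    logn p #|'Mho^n(B) :&: Y| = logn p #|'Mho^n(B) :&: Y'|.
  have := conj_typ_quotient p_pr n pB cBB sYB; have := conj_typ_quotient p_pr n pB cBB sYB'.
  by rewrite eqc; lia.
have [lemN | ltNm] := leqP m (logn p #|B|).
  rewrite -(subKn lemN); elim: (_ - m)%N => [|k IHk]; last first.
    have [ltk | lek] := ltnP k (logn p #|B|); first by apply: step; rewrite subnSK.
    by rewrite (eqP (leqW lek)) -(eqP lek).
  by rewrite subn0 (Mho_eq1 p_pr pB) // !(setIidPl _) ?sub1G.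
by rewrite (Mho_eq1 p_pr pB) ?(ltnW ltNm) // !(setIidPl _) ?sub1G.
Qed.

Section KleinTransitive.

Variables (p : nat) (gT : finGroupType) (B : {group gT}).
Hypotheses (p_pr : prime p) (pB : p.-group B) (cBB : abelian B).
Implicit Types X : {group gT}.

Lemma gamlr2E X r : 'Mho^2(X) = 1 -> gamlr p X B 2 r = typ p (B / 'Mho^1(X :&: 'Mho^r(B))).
Proof. by move=> X2; rewrite /gamlr X2 joing1G Mho0. Qed.

Lemma gamlr20 X : X \subset B -> 'Mho^2(X) = 1 -> gamlr p X B 2 0 = typ p (B / 'Mho^1(X)).
Proof. by move=> sXB X2; rewrite gamlr2E // Mho0 (setIidPl sXB). Qed.

(** The partition gamma^0 gives the orders of X :&: p^m B. For the other family one starts from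
    gamma^1 at r = 0, and the numbers of boxes with subscript r+1 in each row lead from B / p(X :&:
    p^r B) to the next quotient. *)
Lemma klein2_transitive X X' T : nst T = 2 -> has_klein p X B T -> has_klein p X' B T ->
  exists2 a, a \in Aut B & a @: X = X'.
Proof.
move=> T2 [sXB X2 gX stX] [sXB' X2' gX' stX']; rewrite T2 in X2 X2' gX gX' stX stX'.
have [_ _ cX] := stX 2 isT; have [_ _ cX'] := stX' 2 isT.
apply: (square_bounded_transitive p_pr pB cBB) => // [m|r m].
  apply: (eq_conj_card p_pr pB cBB sXB sXB') => {}m.
  by have := gX 0 isT; rewrite (gX' 0) // !Mho0 => ->.
have sUB (Z : {group gT}) : Z \subset B -> 'Mho^1(Z :&: 'Mho^r(B)) \subset B.
  by move=> sZB; rewrite (subset_trans (Mho_sub _ _)) // (subset_trans (subsetIl _ _)).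
apply: (eq_conj_card p_pr pB cBB (sUB X sXB) (sUB X' sXB')) => {}m /=.
rewrite -!gamlr2E //; elim: r {sUB} => [|r IHr].
  by rewrite !gamlr20 //; have := gX 1%N isT; rewrite (gX' 1%N) // => ->.
by rewrite -cX // -cX' //= IHr.
Qed.

Lemma klein1_transitive X X' T : nst T = 1%N -> has_klein p X B T -> has_klein p X' B T ->
  exists2 a, a \in Aut B & a @: X = X'.
Proof.
move=> T1 [sXB X1 gX _] [sXB' X1' gX' _]; rewrite T1 in X1 X1' gX gX'.
have sq1 (Z : {group gT}) : Z \subset B -> 'Mho^1(Z) = 1 -> 'Mho^2(Z) = 1.
  by move=> sZB Z1; apply/trivgP; rewrite -Z1; apply: Mho_leq.
have U1 (Z : {group gT}) r : 'Mho^1(Z) = 1 -> 'Mho^1(Z :&: 'Mho^r(B)) = 1.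
  by move=> Z1; apply/trivgP; rewrite /= -Z1; apply/MhoS/subsetIl.
apply: (square_bounded_transitive p_pr pB cBB); rewrite ?sq1 //.
  move=> n; apply: (eq_conj_card p_pr pB cBB sXB sXB') => {}m.
  by have := gX 0 isT; rewrite (gX' 0) // !Mho0 => ->.
by move=> r m; rewrite !U1.
Qed.

End KleinTransitive.

Lemma typ_quotient_injm p (aT rT : finGroupType) (B Y : {group aT})
    (f : {morphism B >-> rT}) :
  'injm f -> Y <| B -> typ p (f @* B / f @* Y) = typ p (B / Y).
Proof.
move=> injf nsYB; apply/esym/typ_isog.
rewrite /= -(morphim_quotm f nsYB B); apply/sub_isog => //; exact: injm_quotm.
Qed.

Lemma has_klein_injm p (aT rT : finGroupType) (A B : {group aT})
    (f : {morphism B >-> rT}) T :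
  'injm f -> abelian B -> has_klein p A B T -> has_klein p (f @* A) (f @* B) T.
Proof.
move=> injf cBB [sAB A1 gA stA].
have sMB j : 'Mho^j(A) \subset B := subset_trans (Mho_sub j A) sAB.
have typE (Y : {group aT}) : Y \subset B -> typ p (f @* B / f @* Y) = typ p (B / Y).
  by move=> sYB; apply: typ_quotient_injm; rewrite // -sub_abelian_normal.
split; first exact: morphimS.
- by rewrite -morphim_Mho // A1 morphim1.
- by move=> j lej; rewrite gA // -morphim_Mho // typE ?sMB.
move=> l /stA[st1 st2 st3]; split=> // m r m_gt0 r_gt0.
suff gE s : gamlr p (f @* A) (f @* B) l s = gamlr p A B l s by rewrite !gE st3.
have sIB : 'Mho^(l - 2)(A) :&: 'Mho^s(B) \subset B := subset_trans (subsetIl _ _) (sMB _).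
have sIM : 'Mho^1('Mho^(l - 2)(A) :&: 'Mho^s(B)) \subset B := subset_trans (Mho_sub 1 _) sIB.
rewrite /gamlr -!morphim_Mho // -injmI // -morphim_Mho // -morphimY // typE //.
by rewrite join_subG sMB.
Qed.

Section OrbitCount.

Variables (p : nat) (gT : finGroupType) (B : {group gT}).
Hypotheses (p_pr : prime p) (pB : p.-group B) (cBB : abelian B).
Implicit Types X F : {group gT}.

Lemma autS_cardE (A : {set gT}) : autS_card A B = #|'N_(Aut B)(A | 'P)|.
Proof.
apply: eq_card => a; rewrite !inE; congr (_ && _).
by apply/subsetP/subsetP=> sA x; [move=> Ax; rewrite inE; apply: sA; apply/imsetP; exists x |
   case/imsetP=> y Ay ->; have := sA y Ay; rewrite inE].
Qed.

Lemma aut_klein a F T : a \in Aut B -> has_klein p F B T ->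
  exists2 F1 : {group gT}, F1 = a @: F :> {set gT} & has_klein p F1 B T.
Proof.
move=> autA hF; have sFB : F \subset B by case: hF.
exists (autm autA @* F)%G; first by rewrite /= morphimEsub //; apply: eq_imset.
have defB : (autm autA @* B)%G = B by apply: val_inj; apply: im_autm.
by have := has_klein_injm (injm_autm autA) cBB hF; rewrite defB.
Qed.

Lemma orbitP_aut (G : {group {perm gT}}) (A C : {set gT}) :
  reflect (exists2 a, a \in G & a @: A = C) (C \in orbit 'P^* G A).
Proof.
by apply: (iffP imsetP) => -[a Ga]; [move=> -> | move=> <-]; exists a => //;
  rewrite /= /setact; apply: eq_imset.
Qed.

Lemma astabs_imsetP (A : {set gT}) (a : {perm gT}) : reflect (a @: A = A) (a \in 'N(A | 'P)).
Proof.
rewrite -astab1_set; have aE : ('P^*)%act A a = a @: A by apply: eq_imset.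
by apply: (iffP astab1P); rewrite aE.
Qed.

(** Orbit-stabilizer for a single orbit. Since the class depends only on T, [autS_card] takes the
    same value at all its members, so the choice made in [autS_tab] is immaterial. *)
Lemma card_klein_class F T :
    (forall X X', has_klein p X B T -> has_klein p X' B T -> exists2 a, a \in Aut B & a @: X = X') ->
    has_klein p F B T ->
  (#|[set X : {group gT} | `[< has_klein p X B T >]]| * autS_card F B)%N = #|Aut B|.
Proof.
move=> trT hF; rewrite autS_cardE -astab1_set mulnC.
rewrite -[RHS](LagrangeI _ 'C[gval F | 'P^*]) -indexgI -card_orbit; congr (_ * _)%N.
rewrite -(card_imset _ val_inj); congr #|pred_of_set _|.
apply/setP=> C; apply/imsetP/orbitP_aut.
  case=> X; rewrite inE => /asboolP hX ->; exact: trT.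
case=> a autA defC; have [F1 defF1 hF1] := aut_klein autA hF.
by exists F1; [rewrite inE; apply/asboolP | rewrite /= defF1].
Qed.

(** An automorphism carrying Y to Y', where pY = pY' = X, stabilizes X; so the fibre is one orbit of
    the stabilizer of X, and the stabilizer of Y in [Aut B] lies inside that group. *)
Lemma card_klein_fiber F X T1 T2 :
    nst T1 = 1%N -> nst T2 = 2 -> gam T1 0 = gam T2 1 -> gam T1 1 = gam T2 2 ->
    has_klein p F B T2 -> has_klein p X B T1 ->
  (#|[set Y : {group gT} | `[< has_klein p Y B T2 >] & 'Mho^1(Y) == X :> {set gT}]|
    * autS_card F B)%N = autS_card X B.
Proof.
move=> nT1 nT2 g0 g1 hF hX.
have Mho_klein (Y : {group gT}) : has_klein p Y B T2 -> has_klein p ('Mho^1(Y)) B T1.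
  case=> sYB Y2 gY _; rewrite nT2 in Y2 gY.
  have [pY cY] := (pgroupS sYB pB, abelianS sYB cBB).
  split; rewrite ?nT1; first exact: subset_trans (Mho_sub _ _) sYB.
  - by rewrite /= (Mho_add _ _ pY cY).
  - move=> [|[|]] // _; first by rewrite g0 gY //= Mho0.
    by rewrite g1 gY //= (Mho_add 1%N 1%N pY cY).
  by move=> [|[]].
have tr1 := klein1_transitive p_pr pB cBB nT1.
have tr2 := klein2_transitive p_pr pB cBB nT2.
(* F need not lie over X, only over a subgroup with the same tableau; an automorphism moves it to F0
   with p F0 = X. *)
have [a autA aX] := tr1 _ _ (Mho_klein _ hF) hX.
have [F0 defF0 hF0] := aut_klein autA hF.
have Mho_im (b : {perm gT}) (Y Z : {group gT}) : b \in Aut B -> Y \subset B -> Z = b @: Y :> {set gT} ->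
    'Mho^1(Z) = b @: 'Mho^1(Y).
  move=> autb sYB defZ; have defZ' : Z :=: autm autb @* Y.
    by rewrite defZ /= morphimEsub //; apply: eq_imset.
  rewrite defZ' -morphim_Mho // morphimEsub ?(subset_trans (Mho_sub _ _)) //.
have sFB : F \subset B by case: hF.
have sF0B : F0 \subset B by case: hF0.
have F0X : 'Mho^1(F0) = X by rewrite (Mho_im a F) // aX.
have -> : autS_card F B = autS_card F0 B.
  have := card_klein_class tr2 hF; rewrite -(card_klein_class tr2 hF0) => /eqP.
  rewrite eqn_pmul2l; first by move/eqP.
  by apply/card_gt0P; exists F; rewrite inE; apply/asboolP.
rewrite !autS_cardE; set G := ('N_(Aut B)(X | 'P))%G.
have Mho_G a0 (Y Z : {group gT}) : a0 \in Aut B -> Y \subset B -> 'Mho^1(Y) = X ->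
    a0 @: Y = Z -> (a0 \in G) = ('Mho^1(Z) == X :> {set gT}).
  move=> auta sYB YX defZ; rewrite /G in_setI auta /= (Mho_im a0 Y) // YX.
  by apply/astabs_imsetP/eqP.
have -> : 'N_(Aut B)(F0 | 'P) = 'C_G[gval F0 | 'P^*].
  rewrite astab1_set; apply/setP=> a0; rewrite [in RHS]inE.
  apply/setIP/andP=> [[auta NF0] | [/setIP[auta _] NF0]]; split=> //.
  by rewrite (Mho_G a0 F0 F0) ?F0X //; apply/astabs_imsetP.
rewrite mulnC -[RHS](LagrangeI G 'C[gval F0 | 'P^*]) -indexgI -card_orbit; congr (_ * _)%N.
rewrite -(card_imset _ val_inj); congr #|pred_of_set _|.
apply/setP=> C; apply/imsetP/orbitP_aut.
  case=> Y; rewrite inE => /andP[/asboolP hY YX] ->.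
  have [a0 auta aF0] := tr2 _ _ hF0 hY.
  by exists a0; rewrite // (Mho_G a0 F0 Y).
case=> a0 Ga defC; have auta : a0 \in Aut B by case/setIP: Ga.
have [F1 defF1 hF1] := aut_klein auta hF0.
exists F1; last by rewrite /= defF1.
by rewrite inE -(Mho_G a0 F0 F1) // Ga andbT; apply/asboolP.
Qed.

End OrbitCount.

Section CountInModel.

Variables (p : nat) (gT : finGroupType) (Q : {group gT}).
Hypotheses (p_pr : prime p) (pQ : p.-group Q) (cQQ : abelian Q).

Lemma card_klein_extensions (X : {group gT}) T1 T2 :
    nst T1 = 1%N -> nst T2 = 2 -> gam T1 0 = gam T2 1 -> gam T1 1 = gam T2 2 ->
    has_klein p X Q T1 ->
  (#|[set Y : {group gT} | `[< has_klein p Y Q T2 >] & 'Mho^1(Y) == X :> {set gT}]|%:R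
    = (autS_tab p T1)%:R / (autS_tab p T2)%:R :> rat)%R.
Proof.
move=> nT1 nT2 g0 g1 hX; set S := [set Y | _].
pose beta := gam T1 1; pose M := [set: Mty p beta]%G.
have tQ : typ p Q = beta.
  have [_ X1 gX _] := hX; rewrite nT1 in X1 gX; rewrite /beta gX //=.
  by apply: typ_isog; rewrite /= X1; apply: quotient1_isog.
have pM : p.-group M by apply: Mty_pgroup.
have cM : abelian M by apply: Mty_abelian.
have tM : typ p M = beta by rewrite /M typ_Mty // -tQ typ_partition.
have /isogP[f injf imf] : Q \isog M by apply: (@typ_isogP p) => //; rewrite tQ tM.
have defM : (f @* Q)%G = M by apply: val_inj.
have to_M (Y : {group gT}) T : has_klein p Y Q T -> has_klein p (f @* Y) M T.
  by move=> hY; have := has_klein_injm injf cQQ hY; rewrite defM.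
have to_Q (Y : {group Mty p beta}) T : has_klein p Y M T ->
    exists2 Z : {group gT}, (f @* Z)%G = Y & has_klein p Z Q T.
  move=> hY; have [Z [sZQ defY]] : exists Z : {group gT}, Z \subset Q /\ (f @* Z)%G = Y.
    exists (f @*^-1 Y)%G; split; first exact: subsetIl.
    by apply: val_inj; rewrite /= morphpreK // imf subsetT.
  exists Z => //; rewrite -defY -defM in hY.
  have injg := injm_invm injf.
  have imZ (W : {group gT}) : W \subset Q -> (invm injf @* (f @* W))%G = W.
    by move=> sWQ; apply: val_inj; rewrite /= morphim_invm.
  have cfQ : abelian (f @* Q) by rewrite morphim_abelian.
  by have := has_klein_injm injg cfQ hY; rewrite !imZ.
have cardS : #|S| = #|[set Y : {group Mty p beta} |
    `[< has_klein p Y M T2 >] & 'Mho^1(Y) == (f @* X)%G :> {set _}]|.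
  have sQ (Y : {group gT}) T : has_klein p Y Q T -> Y \subset Q by case.
  have inj : {in S &, injective (fun Y : {group gT} => (f @* Y)%G)}.
    move=> Y Z; rewrite !inE => /andP[/asboolP hY _] /andP[/asboolP hZ _] /(congr1 val) /= eqYZ.
    by apply: val_inj; apply: (injm_morphim_inj injf) => //; [apply: sQ hY | apply: sQ hZ].
  rewrite -(card_in_imset inj); congr #|pred_of_set _|; apply/setP=> Y.
  apply/imsetP/idP=> [[Z] | ].
    rewrite !inE => /andP[/asboolP hZ /eqP ZX] ->; rewrite -morphim_Mho ?ZX ?eqxx ?andbT //.
      by apply/asboolP/to_M.
    exact: sQ hZ.
  rewrite !inE => /andP[/asboolP /to_Q[Z <- hZ]] YX; exists Z => //; rewrite !inE.
  apply/andP; split; first exact/asboolP.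
  have sZ := sQ _ _ hZ; rewrite -morphim_Mho // in YX; apply/eqP.
  apply: (injm_morphim_inj injf); [|exact: sQ hX | exact/eqP].
  exact: subset_trans (Mho_sub _ _) sZ.
have [A1 hA1 eA1] : exists2 A1 : {group Mty p beta}, has_klein p A1 M T1 &
    autS_tab p T1 = autS_card A1 M.
  rewrite /autS_tab nT1; case: pickP => [A /asboolP hA | /(_ (f @* X)%G)].
    by exists A.
  by move/asboolP; case; apply: to_M.
have hfX := to_M _ _ hX.
rewrite cardS eA1 /autS_tab nT2 -g1 -/beta.
case: pickP => [A0 /asboolP hA0 | no]; last first.
  rewrite (_ : #|_| = 0); first by rewrite invr0 mulr0.
  apply/eqP; rewrite cards_eq0; apply/eqP/setP=> Y; rewrite !inE.
  by have := no Y => /= ->.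
(* The subgroup picked by [autS_tab] and the image of X may differ but share the tableau T1, hence
   have equally many automorphisms. *)
have -> : autS_card A1 M = autS_card (f @* X) M.
  have tr1 := klein1_transitive p_pr pM cM nT1.
  have := card_klein_class cM tr1 hA1; rewrite -(card_klein_class cM tr1 hfX) => /eqP.
  rewrite eqn_pmul2l; first by move/eqP.
  by apply/card_gt0P; exists A1; rewrite inE; apply/asboolP.
have <- := card_klein_fiber p_pr pM cM nT1 nT2 g0 g1 hA0 hfX.
have A0_gt0 : 0 < autS_card A0 M by rewrite autS_cardE cardG_gt0.
by rewrite natrM mulfK // Num.Theory.pnatr_eq0 -lt0n.
Qed.

End CountInModel.

(** * The chain of layers *)

Lemma gam_restr T u l j : j <= u -> gam (restr T u l) j = gext T (l - u + j).
Proof.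
move=> leju; rewrite -[LHS]/(nth [::] [seq gext T i | i <- iota (l - u) u.+1] j) (nth_map 0) ?size_iota ?nth_iota //.
Qed.

Lemma nst_restr T u l : nst (restr T u l) = u.
Proof. by rewrite /nst /restr size_map size_iota. Qed.

Lemma phi_restr T u l j : 1 < j <= u -> phi (restr T u l) j = phext T (l - u + j).
Proof.
move=> /andP[j_gt1 leju]; have lt : j - 2 < u.-1 by lia.
rewrite -[LHS]/(nth [::] [seq phext T i | i <- iota (l - u + 2) u.-1] (j - 2)).
by rewrite (nth_map 0) ?size_iota ?nth_iota //; congr phext; lia.
Qed.

Lemma has_kleinE p (gT : finGroupType) (A B : {group gT}) T :
  has_klein p A B T <->
  [/\ A \subset B, 'Mho^(nst T)(A) = 1,
      (forall j, j <= nst T -> gam T j = typ p (B / 'Mho^j(A))) &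
      forall l, 2 <= l <= nst T ->
        stripe (gam T l) (gam T l.-1) (phi T l) (gamlr p A B l)].
Proof. by []. Qed.

Lemma eq_stripe g1 g0 f h h' : h =1 h' -> stripe g1 g0 f h -> stripe g1 g0 f h'.
Proof. by move=> eqh [st1 st2 st3]; split=> // m r m0 r0; rewrite -!eqh st3. Qed.

(** An equivalence of predicates rather than an equality of tableaux: restriction rebuilds both
    lists, and only the entries read through [gam] and [phi] are compared. *)
Lemma has_klein_restr_full p (gT : finGroupType) (A B : {group gT}) T :
  has_klein p A B (restr T (nst T) (nst T)) <-> has_klein p A B T.
Proof.
rewrite !has_kleinE nst_restr.
have gE j : j <= nst T -> gam (restr T (nst T) (nst T)) j = gam T j.
  by move=> lej; rewrite gam_restr // subnn /gext lej.
have fE j : 1 < j <= nst T -> phi (restr T (nst T) (nst T)) j = phi T j.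
  by move=> lej; rewrite phi_restr // subnn /phext add0n; case/andP: lej => _ ->.
split=> -[sAB A1 gA stA]; split=> // [j lej | l lel].
- by rewrite -gE ?gA.
- by rewrite -fE // -!gE; [exact: stA | lia | lia].
- by rewrite gE ?gA.
- by rewrite fE // !gE; [exact: stA | lia | lia].
Qed.

Section Chain.

Variables (p : nat) (gT : finGroupType) (B : {group gT}).
Hypotheses (p_pr : prime p) (pB : p.-group B) (cBB : abelian B).
Implicit Types A C D F Y : {group gT}.

Lemma typ_third C Y : C \subset Y -> Y \subset B -> typ p (B / C / (Y / C)) = typ p (B / Y).
Proof.
move=> sCY sYB; apply: typ_isog; apply: third_isog; rewrite -?sub_abelian_normal //.
exact: subset_trans sYB.
Qed.

Lemma quotient_Mho n C Y : C \subset B -> Y \subset B -> 'Mho^n(Y / C) = 'Mho^n(Y) / C.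
Proof.
by move=> sCB sYB; rewrite /quotient morphim_Mho // (subset_trans sYB) ?sub_abelian_norm.
Qed.

(** Dropping the first stripe replaces A by pA. The index starts at 3 because the exponent l - 2
    must stay positive for A to enter through pA. *)
Lemma gamlrS l r A : A \subset B -> gamlr p A B l.+3 r = gamlr p ('Mho^1(A)) B l.+2 r.
Proof.
move=> sAB; rewrite /gamlr.
have MM n : 'Mho^n('Mho^1(A)) = 'Mho^n.+1(A).
  by rewrite (@Mho_add p) ?addn1 //; [apply: pgroupS pB | apply: abelianS cBB].
by rewrite !MM -subSn.
Qed.

(** The subgroup defining [gamlr] at l = 2 contains p^2 F = C, and since C lies in F, intersecting F
    with p^r B commutes with the quotient by C. *)
Lemma gamlr_quotient C F r : F \subset B -> C :=: 'Mho^2(F) ->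
  gamlr p (F / C) (B / C) 2 r = gamlr p F B 2 r.
Proof.
move=> sFB defC; have sMF : C \subset F by rewrite defC Mho_sub.
have sCB := subset_trans sMF sFB.
have sIB : F :&: 'Mho^r(B) \subset B := subset_trans (subsetIl _ _) sFB.
have sUB : 'Mho^1(F :&: 'Mho^r(B)) \subset B := subset_trans (Mho_sub 1 _) sIB.
have nC Y : Y \subset B -> Y \subset 'N(C).
  by move=> sYB; rewrite (subset_trans sYB) ?sub_abelian_norm.
rewrite /gamlr !Mho0 quotient_Mho // -defC quotient_Mho //.
rewrite -quotientGI // quotient_Mho // -quotientY ?nC //.
by rewrite typ_third ?joing_subl // join_subG sCB.
Qed.

Lemma klein_chain_Mho T e k F : has_klein p F B (restr T k.+1 e) -> k < e ->
  has_klein p ('Mho^1(F)) B (restr T k e).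
Proof.
rewrite !has_kleinE !nst_restr => -[sFB F1 gF stF] ltke.
have MM n : 'Mho^n('Mho^1(F)) = 'Mho^n.+1(F).
  by rewrite (@Mho_add p) ?addn1 //; [apply: pgroupS pB | apply: abelianS cBB].
split; rewrite ?MM //; first exact: subset_trans (Mho_sub _ _) sFB.
  move=> j lejk /=; rewrite MM -(gF j.+1) // !gam_restr //; congr (gext T _); lia.
move=> l lel; have lel' : 1 < l.+1 <= k.+1 by lia.
have := stF l.+1 lel'; rewrite !phi_restr // !gam_restr; [|lia|lia|lia|lia].
have -> : e - k.+1 + l.+1 = e - k + l by lia.
have -> : e - k.+1 + l.+1.-1 = e - k + l.-1 by lia.
by case: l lel {lel'} => [|[|l]] // _; apply: eq_stripe => r; apply: gamlrS.
Qed.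

Section Step.

Variables (T : tableau) (k : nat) (D : {group gT}).
Let e := nst T.
Hypotheses (ltke : k < e) (kleinD : has_klein p D B (restr T k e)).
(** C will be p^2 F for the subgroups F with pF = D, and the restrictions are taken at l = e-k+1,
    the index of the factor contributed by this step. *)
Let C := ('Mho^1(D))%G.
Let T1 := restr T 1 (e - k + 1).
Let T2 := restr T 2 (e - k + 1).

Let sDB : D \subset B. Proof. by case: kleinD. Qed.
Let sCD : C \subset D. Proof. exact: Mho_sub. Qed.
Let sCB : C \subset B. Proof. exact: subset_trans sCD sDB. Qed.

Let typ_C : typ p (B / C) = gext T (e - k + 1).
Proof.
have [_ D1 gD _] := kleinD; rewrite nst_restr in D1 gD.
(* For k = 0 the group D is trivial and the index e+1 lies past the last stripe, where [gext]
   repeats gamma^e. *)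
have [k0 | k_gt0] := posnP k; last by rewrite -(gD 1%N) // gam_restr //; congr (gext T _); lia.
rewrite k0 Mho0 in D1; have := gD 0 isT; rewrite gam_restr // k0 subn0 addn0 Mho0 => g0.
rewrite /gext addn1 ltnn -/e -[RHS]/(gam T e).
have -> : gam T e = gext T e by rewrite /gext leqnn.
by rewrite g0 D1 /C /= D1 Mho1.
Qed.

Let typ_D : typ p (B / D) = gext T (e - k).
Proof.
have [_ _ gD _] := kleinD; have := gD 0; rewrite nst_restr => /(_ isT).
by rewrite gam_restr // addn0 Mho0 => ->.
Qed.

Let klein_quotient_D : has_klein p (D / C) (B / C) T1.
Proof.
rewrite has_kleinE nst_restr; split; first exact: quotientS.
- by rewrite /= quotient_Mho // trivg_quotient.
- move=> [|[|]] // _; rewrite gam_restr //.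
    rewrite /= Mho0 typ_third // typ_D; congr (gext T _); lia.
  rewrite /= quotient_Mho // typ_third // typ_C; congr (gext T _); lia.
by move=> [|[|]].
Qed.

(** Conditions on p^j F for j >= 1 and on stripes above the second come from the tableau of D = pF.
    What remains, gamma^0 and the second stripe, concerns quotients of B by subgroups containing C,
    hence is the same in B / C. *)
Lemma klein_step F : 'Mho^1(F) = D -> F \subset B ->
  has_klein p F B (restr T k.+1 e) <-> has_klein p (F / C) (B / C) T2.
Proof.
move=> FD sFB; rewrite !has_kleinE !nst_restr.
have MM n : 'Mho^n.+1(F) = 'Mho^n(D).
  by rewrite -FD (@Mho_add p) ?addn1 //; [apply: pgroupS pB | apply: abelianS cBB].
have [_ D1 gD stD] := (has_kleinE _ _ _ _).1 kleinD; rewrite nst_restr in D1 gD stD.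
have sDF : D \subset F by rewrite -FD Mho_sub.
have sCF := subset_trans sCD sDF.
have defC : C :=: 'Mho^2(F) by rewrite MM.
have eqg0 : (gam (restr T k.+1 e) 0 = typ p (B / 'Mho^0(F)))
    <-> (gam T2 0 = typ p (B / C / 'Mho^0(F / C))).
  rewrite !Mho0 typ_third // !gam_restr //.
  by have -> : e - k.+1 + 0 = e - k + 1 - 2 + 0 by lia.
have gF j : 0 < j <= k.+1 -> gam (restr T k.+1 e) j = typ p (B / 'Mho^j(F)).
  case: j => // j lej; rewrite MM -gD // !gam_restr //; congr (gext T _); lia.
have stF l : 2 < l <= k.+1 -> stripe (gam (restr T k.+1 e) l) (gam (restr T k.+1 e) l.-1)
    (phi (restr T k.+1 e) l) (gamlr p F B l).
  case: l => [|[|[|l]]] // lel; have lel' : 1 < l.+2 <= k by lia.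
  have lel3 : 1 < l.+3 <= k.+1 by lia.
  have := stD l.+2 lel'; rewrite (phi_restr _ _ lel') (phi_restr _ _ lel3).
  rewrite !gam_restr; [|lia|lia|lia|lia].
  have -> : e - k.+1 + l.+3 = e - k + l.+2 by lia.
  have -> : e - k.+1 + l.+3.-1 = e - k + l.+2.-1 by lia.
  apply: eq_stripe => r; rewrite gamlrS //; congr (gamlr p _ B _ _).
  by apply: val_inj; rewrite /= FD.
have eqst2 : 0 < k -> stripe (gam (restr T k.+1 e) 2) (gam (restr T k.+1 e) 1)
    (phi (restr T k.+1 e) 2) (gamlr p F B 2)
    <-> stripe (gam T2 2) (gam T2 1) (phi T2 2) (gamlr p (F / C) (B / C) 2).
  move=> k_gt0; rewrite !phi_restr // !gam_restr //.
  have -> : e - k + 1 - 2 + 2 = e - k.+1 + 2 by lia.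
  have -> : e - k + 1 - 2 + 1 = e - k.+1 + 1 by lia.
  by split; apply: eq_stripe => r; rewrite gamlr_quotient.
split=> -[_ F1 gF' stF'].
  split; first exact: quotientS.
  - by rewrite /= quotient_Mho // -defC trivg_quotient.
  - move=> [|[|[|]]] // _; first by apply/eqg0; apply: gF'.
      rewrite gam_restr //= quotient_Mho // FD typ_third // typ_D; congr (gext T _); lia.
    rewrite gam_restr //= quotient_Mho // -defC typ_third // typ_C; congr (gext T _); lia.
  case=> [|[|[|]]] //= _; have [k0 | k_gt0] := posnP k; last first.
    by apply/eqst2 => //; apply: stF'; lia.
  (* For k = 0 the left side has only one stripe and imposes no condition on a second one. On the
     right the second stripe is empty and all its chain is constant, because pF = D = 1. *)
  have D1' : D :=: 1 by move: D1; rewrite k0 Mho0.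
  have gam21 : gam T2 2 = gam T2 1.
    rewrite !gam_restr // k0 /gext !subn0.
    have -> : (e + 1 - 2 + 2 <= nst T) = false by rewrite -/e; lia.
    have -> : e + 1 - 2 + 1 = nst T by rewrite -/e; lia.
    by rewrite leqnn.
  have nobox i : (nth 0 (gam T2 2) i == (nth 0 (gam T2 1) i).+1) = false.
    by rewrite gam21 (ltn_eqF (ltnSn _)).
  split=> [i | i j _ | m r _ _]; rewrite ?nobox //.
  rewrite (_ : #|_| = 0); last first.
    by apply/eqP; rewrite cards_eq0; apply/eqP/setP=> i; rewrite !inE nobox.
  rewrite !gamlr_quotient //.
  have gam1 s : gamlr p F B 2 s = typ p (B / 1).
    rewrite /gamlr Mho0; have -> : 'Mho^2(F) <*> 'Mho^1(F :&: 'Mho^s(B)) = 1; last by [].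
    have sD1 : D \subset 1%G by rewrite D1'.
    apply/trivgP; apply: subset_trans sD1; rewrite /= join_subG MM Mho_sub /= -FD.
    exact/MhoS/subsetIl.
  by rewrite !gam1.
split=> //.
- by rewrite MM.
- move=> [|j] lej; last exact: gF.
  by apply/eqg0; apply: gF'.
move=> [|[|[|l]]] // lel; last by apply: stF.
by apply/eqst2; [lia | apply: (stF' 2)].
Qed.

Lemma card_klein_step :
  (#|[set F : {group gT} | `[< has_klein p F B (restr T k.+1 e) >] & 'Mho^1(F) == D :> {set gT}]|%:R
   = (autS_tab p T1)%:R / (autS_tab p T2)%:R :> rat)%R.
Proof.
have pQ : p.-group (B / C) := quotient_pgroup _ pB.
have cQ : abelian (B / C) := quotient_abelian _ cBB.
rewrite -(card_klein_extensions p_pr pQ cQ _ _ _ _ klein_quotient_D) ?nst_restr //; first last.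
- rewrite !gam_restr //; congr (gext T _); lia.
- rewrite !gam_restr //; congr (gext T _); lia.
congr (_%:R)%R; set S := [set F | _].
have SP F : F \in S -> [/\ has_klein p F B (restr T k.+1 e), 'Mho^1(F) = D, F \subset B & C <| F].
  rewrite inE => /andP[/asboolP hF /eqP FD]; have sFB : F \subset B by case: hF.
  split=> //; rewrite -sub_abelian_normal ?(abelianS sFB) //.
  by rewrite (subset_trans sCD) // -FD Mho_sub.
have inj : {in S &, injective (fun F => (F / C)%G)}.
  move=> F F' /SP[_ _ _ nF] /SP[_ _ _ nF'] /(congr1 val) /= eqF.
  by apply: val_inj; apply: quotient_inj eqF.
rewrite -(card_in_imset inj); congr #|pred_of_set _|; apply/setP=> Y.
apply/imsetP/idP=> [[F /SP[hF FD sFB _] ->] | ].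
  rewrite !inE; apply/andP; split; first by apply/asboolP/klein_step.
  by rewrite /= quotient_Mho // FD.
rewrite !inE => /andP[/asboolP hY /eqP YX].
have sYQ : Y \subset B / C by case: hY.
have nCB : C <| B by rewrite -sub_abelian_normal.
pose F := (coset C @*^-1 Y)%G.
have defY : Y = (F / C)%G by apply: val_inj; rewrite /= cosetpreK.
have sFB : F \subset B by rewrite -(quotientGK nCB) morphpreS.
have nC (Z : {group gT}) : Z \subset B -> Z \subset 'N(C).
  by move=> sZB; rewrite (subset_trans sZB) ?normal_norm.
have sCF : C \subset F by rewrite -{1}ker_coset; apply: morphpreS (sub1G _).
have sDF : D \subset F.
  have : D / C \subset F / C by rewrite -YX cosetpreK Mho_sub.
  by rewrite quotientSK ?nC // mulSGid.
(* The equality holds modulo C and lifts, since D in F gives C = pD inside pF. *)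
have FD : 'Mho^1(F) = D.
  have sMB : 'Mho^1(F) \subset B := subset_trans (Mho_sub 1 F) sFB.
  have nrm (Z : {group gT}) : Z \subset B -> C \subset Z -> C <| Z.
    by move=> sZB sCZ; rewrite -sub_abelian_normal ?(abelianS sZB).
  apply: (quotient_inj (nrm ('Mho^1(F))%G sMB _) (nrm D sDB sCD)); first exact: MhoS.
  by rewrite -quotient_Mho // cosetpreK.
exists F => //; rewrite inE FD eqxx andbT; apply/asboolP/klein_step => //.
by rewrite -defY.
Qed.

End Step.

Theorem card_klein_tableau T : typ p B = gam T (nst T) ->
  (#|[set F : {group gT} | `[< has_klein p F B T >]]|%:R =
    \prod_(2 <= l < (nst T).+2) ((autS_tab p (restr T 1 l))%:R / (autS_tab p (restr T 2 l))%:R)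
    :> rat)%R.
Proof.
move=> tB; set e := nst T.
pose f l : rat := ((autS_tab p (restr T 1 l))%:R / (autS_tab p (restr T 2 l))%:R)%R.
(* Here k counts the stripes taken from the outer end: [restr T k e] is the tableau expected of
   p^(e-k) U. *)
suff main k : k <= e -> (#|[set F : {group gT} | `[< has_klein p F B (restr T k e) >]]|%:R
    = \prod_(e - k + 2 <= l < e.+2) f l :> rat)%R.
  have := main e (leqnn e); rewrite subnn => <-; congr (_%:R)%R.
  by apply: eq_card => F; rewrite !inE; apply/asboolP/asboolP => /has_klein_restr_full.
elim: k => [_ | k IHk ltke].
  rewrite subn0 addn2 big_geq // -[RHS]/(1%:R)%R; congr (_%:R)%R.
  apply/eqP/cards1P; exists 1%G; apply/setP=> F; rewrite !inE.
  apply/asboolP/eqP => [[_] | ->]; first by rewrite nst_restr Mho0 => F1 _ _; apply: val_inj.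
  rewrite has_kleinE nst_restr; split; rewrite ?sub1G ?Mho0 //.
    move=> [|//] _; rewrite gam_restr // subn0 addn0 /gext leqnn -tB Mho0.
    by apply: typ_isog; apply: quotient1_isog.
  by move=> [|[]].
rewrite big_ltn; last by lia.
have -> : (e - k.+1 + 2).+1 = e - k + 2 by lia.
have -> : e - k.+1 + 2 = e - k + 1 by lia.
rewrite -(IHk (ltnW ltke)); set S := [set F | _]; set S' := [set F | _].
have SS' F : F \in S -> 'Mho^1(F)%G \in S'.
  by rewrite !inE => /asboolP hF; apply/asboolP; apply: klein_chain_Mho.
(* The subgroups with k+1 stripes are sorted by pF. All fibres have the same size, so the sum is a
   product. *)
rewrite -sum1_card (partition_big _ _ SS') /= natr_sum.
rewrite (eq_bigr (fun=> f (e - k + 1))) ?sumr_const ?mulr_natr // => D DS.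
have : D \in S' by exact: DS.
rewrite inE => /asboolP hD; rewrite sum1dep_card /f -(card_klein_step ltke hD).
congr (_%:R)%R; apply: eq_card => F; rewrite !inE.
by congr (_ && _).
Qed.

End Chain.

(** * The tableau of an embedding *)

Section Inequalities.

Variables (p : nat) (gT : finGroupType) (B : {group gT}).
Hypotheses (p_pr : prime p) (pB : p.-group B) (cBB : abelian B).
Implicit Types H K L N X Y Z : {group gT}.

Local Notation lg A := (logn p #|A|).
Local Notation M m := 'Mho^m(B).
Local Notation conjQ Y m := (conj (typ p (B / Y)) m).

(** Through |Ohm_1(H)| |pH| = |H| this becomes the inclusion of ['Ohm_1(K)] in ['Ohm_1(H)]. *)
Lemma lg_Mho1_sub H K : K \subset H -> H \subset B ->
  lg ('Mho^1(H)) + lg K <= lg ('Mho^1(K)) + lg H.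
Proof.
move=> sKH sHB; have cH := abelianS sHB cBB; have cK := abelianS sKH cH.
have := lg_Ohm_Mho p 1 cH; have := lg_Ohm_Mho p 1 cK; have := lgS p (OhmS 1 sKH).
by move=> /=; lia.
Qed.

Lemma lg_join_sub N H K : N \subset B -> K \subset H -> H \subset B ->
  lg (N <*> H) + lg K <= lg (N <*> K) + lg H.
Proof.
move=> sNB sKH sHB; have := lgY p cBB sNB sHB; have := lgY p cBB sNB (subset_trans sKH sHB).
by have := lgS p (setIS N sKH) => /=; lia.
Qed.

Lemma Mho1_join H K L : H \subset B -> K \subset B -> 'Mho^1(H) \subset L ->
  'Mho^1(K) \subset L -> 'Mho^1(H <*> K) \subset L.
Proof.
move=> sHB sKB sHL sKL; have sJB : H <*> K \subset B by rewrite join_subG sHB.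
apply/subsetP=> _ /(Mho1P _ (pgroupS sJB pB) (abelianS sJB cBB))[x + ->].
rewrite /= cent_joinEr; last exact: sub_abelian_cent2 cBB sKB sHB.
case/mulsgP=> y z Hy Kz ->; have [By Bz] := (subsetP sHB y Hy, subsetP sKB z Kz).
rewrite expgMn; last exact: (centsP cBB).
apply: groupM; [apply: (subsetP sHL) | apply: (subsetP sKL)].
  by apply/(Mho1P _ (pgroupS sHB pB) (abelianS sHB cBB)); exists y.
by apply/(Mho1P _ (pgroupS sKB pB) (abelianS sKB cBB)); exists z.
Qed.

Lemma Mho1_Mho m : 'Mho^1(M m) = M m.+1.
Proof. by rewrite (Mho_add _ _ pB cBB). Qed.

Lemma sMB m : M m \subset B. Proof. exact: Mho_sub. Qed.

Lemma leMho m : M m.+1 \subset M m. Proof. exact: Mho_leq. Qed.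

Lemma sIMB m Y : M m :&: Y \subset B.
Proof. exact: subset_trans (subsetIl _ _) (sMB m). Qed.

Lemma conj_quotient_sub Y Z m : Y \subset Z -> Z \subset B ->
  conjQ Z m.+1 <= conjQ Y m.+1.
Proof.
move=> sYZ sZB; have sYB := subset_trans sYZ sZB.
have := conj_typ_quotient p_pr m pB cBB sYB; have := conj_typ_quotient p_pr m pB cBB sZB.
have := lgY p cBB (sIMB m Y) (sIMB m.+1 Z).
have -> : (M m :&: Y) :&: (M m.+1 :&: Z) = M m.+1 :&: Y.
  apply/setP=> x; rewrite !inE; have := subsetP (leMho m) x; have := subsetP sYZ x.
  by case: (x \in Y) => [-> // | _]; case: (x \in M m.+1) => [-> // |]; rewrite ?andbF.
have : lg ((M m :&: Y) <*> (M m.+1 :&: Z)) <= lg (M m :&: Z).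
  by apply: (@lgS _ _ (_ <*> _)%G (_ :&: _)%G); rewrite join_subG setIS // setSI // leMho.
by move=> /=; lia.
Qed.

(** Multiplication by p maps p^m B modulo p^(m+1) B + (p^m B :&: Z) onto p^(m+1) B modulo p^(m+2) B
    + (p^(m+1) B :&: Y). This gives both the one-box-per-column bound and axiom (iii). *)
Lemma conj_quotient_Mho Y Z m : Y \subset B -> Z \subset B -> 'Mho^1(M m :&: Z) \subset Y ->
  conjQ Y m.+2 <= conjQ Z m.+1.
Proof.
move=> sYB sZB sZY; pose K := ((M m :&: Z) <*> M m.+1)%G.
have := conj_typ_quotient p_pr m.+1 pB cBB sYB; have := conj_typ_quotient p_pr m pB cBB sZB.
have := lgY p cBB (sIMB m Z) (sMB m.+1).
have -> : (M m :&: Z) :&: M m.+1 = M m.+1 :&: Z.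
  by rewrite setIAC (setIidPr (leMho m)).
have := lgY p cBB (sIMB m.+1 Y) (sMB m.+2).
have -> : (M m.+1 :&: Y) :&: M m.+2 = M m.+2 :&: Y.
  by rewrite setIAC (setIidPr (leMho m.+1)).
have sKM : K \subset M m by rewrite join_subG subsetIl leMho.
have := lg_Mho1_sub sKM (sMB m); rewrite Mho1_Mho.
have : lg ('Mho^1(K)) <= lg ((M m.+1 :&: Y) <*> M m.+2).
  apply: (@lgS _ _ 'Mho^1(K)%G (_ <*> _)%G).
  apply: Mho1_join; rewrite ?sIMB ?sMB //; last by rewrite Mho1_Mho joing_subr.
  apply: subset_trans (joing_subl _ _); rewrite subsetI sZY andbT.
  by rewrite -Mho1_Mho MhoS ?subsetIl.
by move=> /=; lia.
Qed.

(** Row m+1 of the type of B/X is the logarithm of |p^m B + X : p^(m+1) B + X|, and a subgroup of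
    p^(m+1) B changes neither term. *)
Lemma conj_quotient_join X (U : {group gT}) m : X \subset B -> U \subset M m.+1 ->
  conj (typ p (B / (X <*> U))) m.+1 = conjQ X m.+1.
Proof.
move=> sXB sUM; have sUB := subset_trans sUM (sMB m.+1).
have sWB : (X <*> U)%G \subset B by rewrite join_subG sXB.
have := conj_typ_quotient p_pr m pB cBB sXB; have := conj_typ_quotient p_pr m pB cBB sWB.
have eqW n : U \subset M n -> M n <*> (X <*> U) = M n <*> X.
  move=> sUn; rewrite joingA joingC; apply/joing_idPr.
  exact: subset_trans sUn (joing_subl _ _).
have := lgY p cBB (sMB m) sWB; rewrite /= eqW ?(subset_trans sUM (leMho m)) //.
have := lgY p cBB (sMB m.+1) sWB; rewrite /= eqW //.
have := lgY p cBB (sMB m) sXB; have := lgY p cBB (sMB m.+1) sXB.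
by move=> /=; lia.
Qed.

Lemma lg_quotient Y : Y \subset B -> lg (B / Y)%G + lg Y = lg B.
Proof.
move=> sYB; rewrite card_quotient ?sub_abelian_norm // -lognM ?cardG_gt0 //.
by rewrite mulnC Lagrange.
Qed.

Lemma sum_minn_quotient Y m : Y \subset B ->
  \sum_(x <- typ p (B / Y)) minn x m + lg Y + lg (M m) = lg B + lg (M m :&: Y).
Proof.
move=> sYB; have := sum_minn_typ p_pr m (quotient_pgroup Y pB) (quotient_abelian Y cBB).
have := lg_Mho_quotient m pB cBB sYB; have := lg_quotient sYB.
have : lg (M m :&: Y) <= lg Y by apply: (@lgS _ _ (_ :&: _)%G Y); apply: subsetIr.
set a := lg (M m :&: Y); set b := lg Y; set c := lg B.
set d := lg (B / Y)%G; set g := lg ('Mho^m(B / Y)); set h := \sum_(_ <- _) _.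
by lia.
Qed.

Lemma sumn_quotient Y : Y \subset B -> sumn (typ p (B / Y)) + lg Y = lg B.
Proof.
move=> sYB; have := sumn_typ (quotient_pgroup Y pB) (quotient_abelian Y cBB).
by move=> ->; apply: lg_quotient.
Qed.

Variable X : {group gT}.
Hypothesis sXB : X \subset B.
Let pX := pgroupS sXB pB.
Let cX := abelianS sXB cBB.
Let sX1 : 'Mho^1(X) \subset X := Mho_sub 1 X.
Let sX1B : 'Mho^1(X) \subset B := subset_trans sX1 sXB.
Let sX2B : 'Mho^2(X) \subset B := subset_trans (Mho_sub 2 X) sXB.

(** Take H = X and K = pX + (X :&: p^t B): then pK lies in p^2 X + (pX :&: p^(t+1) B). The orders of
    the sums and intersections translate into truncated sums by [sum_minn_quotient]. *)
Lemma lattice_ineq t :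
  \sum_(x <- typ p (B / 'Mho^2(X))) minn x t.+1 + \sum_(x <- typ p (B / X)) minn x t
  <= \sum_(x <- typ p (B / 'Mho^1(X))) minn x t.+1 + \sum_(x <- typ p (B / 'Mho^1(X))) minn x t.
Proof.
have := sum_minn_quotient t sXB; have := sum_minn_quotient t sX1B.
have := sum_minn_quotient t.+1 sX1B; have := sum_minn_quotient t.+1 sX2B.
pose K := ('Mho^1(X) <*> (M t :&: X))%G.
have sKX : K \subset X by rewrite join_subG sX1 subsetIr.
have := lg_Mho1_sub sKX sXB.
have := lgY p cBB sX1B (sIMB t X).
have -> : 'Mho^1(X) :&: (M t :&: X) = M t :&: 'Mho^1(X).
  by rewrite setIC -setIA (setIidPr sX1).
have := lgY p cBB sX2B (sIMB t.+1 'Mho^1(X)%G).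
have -> : 'Mho^2(X) :&: (M t.+1 :&: 'Mho^1(X)) = M t.+1 :&: 'Mho^2(X).
  by rewrite setIC -setIA (setIidPr (Mho_leq X (isT : 1 <= 2))).
have : lg ('Mho^1(K)) <= lg ('Mho^2(X) <*> (M t.+1 :&: 'Mho^1(X))).
  apply: (@lgS _ _ 'Mho^1(K)%G (_ <*> _)%G).
  apply: Mho1_join => //; first exact: sIMB.
    by rewrite (Mho_add _ _ pX cX) joing_subl.
  apply: subset_trans (joing_subr _ _); rewrite subsetI -Mho1_Mho !MhoS ?subsetIl ?subsetIr //.
by move=> /=; lia.
Qed.

Let W r := ('Mho^2(X) <*> 'Mho^1(X :&: M r))%G.

(** Take H = X :&: p^s B and K = (X :&: p^(s+1) B) + (pX :&: p^s B). The logarithm of |H : K| is the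
    number of boxes of the first stripe in row s+1, and |W s : W (s+1)|, which counts subscripts
    s+1, is at most |pH : pK|. *)
Lemma subscript_ineq s :
  sumn (typ p (B / W s.+1)) + conjQ X s.+1 <= sumn (typ p (B / W s)) + conjQ ('Mho^1(X)) s.+1.
Proof.
have sUB r : 'Mho^1(X :&: M r) \subset B.
  exact: subset_trans (Mho_sub 1 _) (subset_trans (subsetIl _ _) sXB).
have sWB r : W r \subset B by rewrite join_subG sX2B sUB.
have := sumn_quotient (sWB s); have := sumn_quotient (sWB s.+1).
have := conj_typ_quotient p_pr s pB cBB sXB; have := conj_typ_quotient p_pr s pB cBB sX1B.
pose K := ((M s.+1 :&: X) <*> (M s :&: 'Mho^1(X)))%G.
pose H := (X :&: M s)%G.
have sHB : H \subset B by rewrite /= setIC sIMB.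
have sKH : K \subset H.
  by rewrite join_subG /= setIC setIS ?leMho //= setIC setSI.
have := lgY p cBB (sIMB s.+1 X) (sIMB s 'Mho^1(X)%G).
have -> : (M s.+1 :&: X) :&: (M s :&: 'Mho^1(X)) = M s.+1 :&: 'Mho^1(X).
  by rewrite setIACA (setIidPl (leMho s)) (setIidPr sX1).
have := lg_Mho1_sub sKH sHB.
have := lg_join_sub sX2B (MhoS 1 sKH) (subset_trans (Mho_sub 1 H) sHB).
have : lg ('Mho^2(X) <*> 'Mho^1(K)) <= lg (W s.+1).
  apply: (@lgS _ _ (_ <*> _)%G (W s.+1)); rewrite join_subG joing_subl /=.
  apply: Mho1_join; rewrite ?sIMB //; first by rewrite setIC joing_subr.
  apply: subset_trans (joing_subl _ _).
  by rewrite -[2]/(1 + 1)%N -(Mho_add 1 1 pX cX) MhoS ?subsetIr.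
have -> : lg (M s :&: X) = lg H by rewrite /= setIC.
have -> : lg (W s) = lg ('Mho^2(X) <*> 'Mho^1(H)) by [].
by move=> /=; lia.
Qed.

End Inequalities.

Section Layer.

Variables (p : nat) (gT : finGroupType) (B : {group gT}).
Hypotheses (p_pr : prime p) (pB : p.-group B) (cBB : abelian B).

Local Notation lg A := (logn p #|A|).

Lemma quotient_partition (Y : {group gT}) : is_partition (typ p (B / Y)).
Proof. exact: typ_partition (quotient_pgroup Y pB) (quotient_abelian Y cBB). Qed.

Lemma strip_quotient (X : {group gT}) : X \subset B ->
  strip (typ p (B / X)) (typ p (B / 'Mho^1(X))).
Proof.
move=> sXB i; have sX1B := subset_trans (Mho_sub 1 X) sXB.
apply/andP; split.
  apply: leq_nth_conj; rewrite ?quotient_partition // => m.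
  exact: (@conj_quotient_sub p gT B p_pr pB cBB 'Mho^1(X)%G X m (Mho_sub 1 X) sXB).
apply: leq_nthS_conj; rewrite ?quotient_partition // => m.
apply: (conj_quotient_Mho p_pr pB cBB sX1B sXB).
by apply: MhoS; apply: subsetIr.
Qed.

Section Subscripts.

Variable X : {group gT}.
Hypothesis sXB : X \subset B.
Let g0 := typ p (B / X).
Let g1 := typ p (B / 'Mho^1(X)).
Let g2 := typ p (B / 'Mho^2(X)).
Let h r := gamlr p X B 2 r.
Let f := first_subscript g1 g2 h (lg B).
Let W r := ('Mho^2(X) <*> 'Mho^1(X :&: 'Mho^r(B)))%G.

Let pX := pgroupS sXB pB.
Let cX := abelianS sXB cBB.
Let sX2B : 'Mho^2(X) \subset B. Proof. exact: subset_trans (Mho_sub 2 X) sXB. Qed.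
Let sX1B : 'Mho^1(X) \subset B. Proof. exact: subset_trans (Mho_sub 1 X) sXB. Qed.

Let hE r : h r = typ p (B / W r).
Proof. by rewrite /h /gamlr Mho0. Qed.

Let sUB r : 'Mho^1(X :&: 'Mho^r(B)) \subset B.
Proof. exact: subset_trans (Mho_sub 1 _) (subset_trans (subsetIl _ _) sXB). Qed.

Let sWB r : W r \subset B. Proof. by rewrite join_subG sX2B sUB. Qed.

Let p0 : is_partition g0. Proof. exact: quotient_partition. Qed.
Let p1 : is_partition g1. Proof. exact: quotient_partition. Qed.
Let p2 : is_partition g2. Proof. exact: quotient_partition. Qed.
Let ph r : is_partition (h r). Proof. by rewrite hE quotient_partition. Qed.

Let st01 : strip g0 g1. Proof. exact: strip_quotient. Qed.
Let st12 : strip g1 g2.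
Proof.
have := strip_quotient sX1B.
by rewrite /= (Mho_add 1 1 pX cX).
Qed.

Lemma gamlr_sub0 : gamlr p X B 2 0 = g1.
Proof.
rewrite /gamlr !Mho0 (setIidPl sXB) /g1.
have -> : 'Mho^2(X) <*> 'Mho^1(X) = 'Mho^1(X); last by [].
by apply/joing_idPr/Mho_leq.
Qed.

Let h0 : h 0 = g1. Proof. exact: gamlr_sub0. Qed.

Let hN : h (lg B) = g2.
Proof.
rewrite /h /gamlr Mho0 (Mho_eq1 p_pr pB) // (setIidPr (sub1G X)) Mho1 joingG1.
by [].
Qed.

Let h_mono r i : nth 0 (h r) i <= nth 0 (h r.+1) i.
Proof.
rewrite !hE; apply: leq_nth_conj; rewrite ?quotient_partition // => m.
apply: (conj_quotient_sub p_pr pB cBB); last exact: sWB.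
by apply: genS; apply: setUS; rewrite MhoS // setIS ?Mho_leq.
Qed.

Let h_le r i : nth 0 (h r) i <= nth 0 g2 i.
Proof.
rewrite hE; apply: leq_nth_conj; rewrite ?quotient_partition // => m.
by apply: (conj_quotient_sub p_pr pB cBB); rewrite ?joing_subl.
Qed.

Let fle i r : nth 0 g2 i == (nth 0 g1 i).+1 -> (f i <= r) = (nth 0 (h r) i == nth 0 g2 i).
Proof. exact: first_subscript_le. Qed.

Lemma stripe_layer : stripe g2 g1 (mkseq f (size g2)) h.
Proof. exact: (stripe_first p1 p2 ph st12 h0 hN h_mono h_le). Qed.

(** For a box in row m, p(X :&: p^(m-1) B) lies in p^m B, so by [conj_quotient_join] row m is
    already complete at step m-1 of the chain. *)
Lemma subscript_bounds i : nth 0 g2 i == (nth 0 g1 i).+1 -> 0 < f i < nth 0 g2 i.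
Proof.
move=> bi; rewrite (first_subscript_gt0 h0 hN h_mono h_le) //=.
rewrite (eqP bi) ltnS fle // eqn_leq h_le (eqP bi) -ltn_conj // hE.
rewrite conj_quotient_join //; last by rewrite -(Mho1_Mho pB cBB) MhoS ?subsetIr.
by rewrite /= ltn_conj // -/g2 (eqP bi).
Qed.

(** Only f i >= m-1 is new, where m is the row of the box. By [conj_quotient_Mho], row m of the
    chain at step m-2 is no longer than row m-1 of gamma^0, which ends before column i. *)
Lemma subscript_below i : nth 0 g2 i == (nth 0 g1 i).+1 -> nth 0 g1 i == (nth 0 g0 i).+1 ->
  f i = (nth 0 g2 i).-1.
Proof.
move=> b2 b1; have /andP[_ lt_f] := subscript_bounds b2.
apply/eqP; rewrite eqn_leq; move: lt_f; rewrite (eqP b2) ltnS /= => -> /=.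
rewrite (eqP b1) ltnNge fle // (eqP b2) (eqP b1) eqn_leq negb_and; apply/orP; right.
rewrite -ltn_conj // -leqNgt.
have le : conj (h (nth 0 g0 i)) (nth 0 g0 i).+2 <= conj g0 (nth 0 g0 i).+1.
  rewrite hE; apply: (conj_quotient_Mho p_pr pB cBB (sWB _) sXB).
  by rewrite /= setIC joing_subr.
by apply: leq_trans le _; rewrite leqNgt ltn_conj // ltnn.
Qed.

Lemma subscript_count r :
  #|[set i : 'I_(size g2) | (nth 0 g2 i == (nth 0 g1 i).+1) && (f i == r)]|
  <= #|[set i : 'I_(size g1) | (nth 0 g1 i == (nth 0 g0 i).+1) && (nth 0 g1 i == r)]|.
Proof.
case: r => [|s].
  rewrite (eq_card (B := pred0)) ?card0 // => i; rewrite !inE.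
  apply/negP=> /andP[/subscript_bounds]; lia.
have := card_first_subscript p1 p2 ph st12 h0 hN h_mono h_le (isT : 0 < s.+1).
have := card_boxes_row p0 p1 st01 (isT : 0 < s.+1) (leqnn _).
have := subscript_ineq p_pr pB cBB sXB s.
by rewrite -!hE -/g1 -/g0 -/f /=; lia.
Qed.

Lemma layer_lattice k : \sum_(k <= i < size g2) (nth 0 g2 i - nth 0 g1 i)
    <= \sum_(k <= i < size g1) (nth 0 g1 i - nth 0 g0 i).
Proof.
apply: lattice_condition => // t.
exact: lattice_ineq.
Qed.

End Subscripts.

End Layer.

Definition klein_tableau p (gT : finGroupType) (A B : {group gT}) (e : nat) : tableau :=
  ([seq typ p (B / 'Mho^j(A)) | j <- iota 0 e.+1],
   [seq mkseq (first_subscript (typ p (B / 'Mho^l.-1(A))) (typ p (B / 'Mho^l(A)))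
                 (gamlr p A B l) (logn p #|B|)) (size (typ p (B / 'Mho^l(A))))
     | l <- iota 2 e.-1]).

Section KleinTableau.

Variables (p : nat) (gT : finGroupType) (A B : {group gT}) (e : nat).
Hypotheses (p_pr : prime p) (pB : p.-group B) (cBB : abelian B).
Hypotheses (sAB : A \subset B) (Ae : 'Mho^e(A) = 1).

Let T := klein_tableau p A B e.
Let pA := pgroupS sAB pB.
Let cA := abelianS sAB cBB.

Local Notation lg A := (logn p #|A|).
Local Notation g j := (typ p (B / 'Mho^j(A))).
Local Notation f l := (first_subscript (g l.-1) (g l) (gamlr p A B l) (lg B)).

Lemma nst_klein : nst T = e.
Proof. by rewrite /nst /= size_map size_iota. Qed.

Lemma gam_klein j : j <= e -> gam T j = g j.
Proof.
move=> lej; rewrite -[LHS]/(nth [::] [seq g i | i <- iota 0 e.+1] j).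
by rewrite (nth_map 0) ?size_iota ?nth_iota.
Qed.

Lemma phi_klein l : 1 < l <= e -> phi T l = mkseq (f l) (size (g l)).
Proof.
case/andP=> l_gt1 lel; have lt : l - 2 < e.-1 by lia.
rewrite -[LHS]/(nth [::] [seq mkseq (f i) (size (g i)) | i <- iota 2 e.-1] (l - 2)).
by rewrite (nth_map 0) ?size_iota ?nth_iota // addnC subnK.
Qed.

Let MM m n : 'Mho^m('Mho^n(A)) = 'Mho^(m + n)(A). Proof. exact: Mho_add pA cA. Qed.

Let sMB j : 'Mho^j(A) \subset B. Proof. exact: subset_trans (Mho_sub j A) sAB. Qed.

(** Stripe l+2 of A is stripe 2 of p^l A, so each axiom only has to be checked on the first two
    stripes of a subgroup. *)
Lemma gamlr_layer l r : gamlr p A B l.+2 r = gamlr p ('Mho^l(A)) B 2 r.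
Proof. by rewrite /gamlr !MM subn2 add2n. Qed.

Let gamlr_layerE l : gamlr p A B l.+2 = gamlr p ('Mho^l(A)) B 2.
Proof. by apply: funext => r; apply: gamlr_layer. Qed.

Let strip_g j : strip (g j) (g j.+1).
Proof. by have := strip_quotient p_pr pB cBB (sMB j); rewrite /= MM add1n. Qed.

Let pg j : is_partition (g j). Proof. exact: quotient_partition. Qed.

Lemma has_klein_tableau : has_klein p A B T.
Proof.
rewrite has_kleinE nst_klein; split=> // [j lej | l lel]; first by rewrite gam_klein.
rewrite phi_klein // !gam_klein; [|lia|lia].
case: l lel => [|[|l]] // lel; rewrite gamlr_layerE.
have := stripe_layer p_pr pB cBB (sMB l).
by rewrite /= !MM.
Qed.

Lemma is_klein_tableau : is_klein T.
Proof.
split.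
- split; first by [].
    by rewrite nst_klein /= size_map size_iota.
  by rewrite nst_klein => j lej; rewrite gam_klein.
- rewrite nst_klein => l i lel; rewrite !gam_klein; [|lia|lia].
  by case: l lel => // l _; apply: strip_g.
- rewrite nst_klein => l k lel k_gt0; rewrite /tailsum !gam_klein; [|lia|lia|lia].
  case: l lel => [|[|l]] // lel.
  have := layer_lattice p_pr pB cBB (sMB l) k.-1.
  by rewrite /= !MM.
rewrite nst_klein => l lel; rewrite /isbox /sub /Defs.row.
have lel1 : l <= e by lia.
have lel2 : l.-1 <= e by lia.
have lel3 : l.-1.-1 <= e by lia.
rewrite /nbox_sub /nbox_row /isbox /sub /Defs.row phi_klein //.
rewrite !(gam_klein lel1) !(gam_klein lel2) !(gam_klein lel3).
case: l lel {lel1 lel2 lel3} => [|[|l]] // lel.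
have fE i : nth 0 (mkseq (f l.+2) (size (g l.+2))) i = f l.+2 i by apply: nth_mkseq_first.
split.
- split; first by rewrite size_mkseq.
  by move=> i /first_subscript_nobox; rewrite fE; apply.
- move=> i bi; rewrite fE gamlr_layerE.
  have := subscript_bounds p_pr pB cBB (sMB l) (i := i).
  by rewrite /= !MM; apply.
- have [_ _ _ /(_ l.+2)] := (has_kleinE _ _ _ _).1 has_klein_tableau.
  rewrite nst_klein => /(_ lel)[_ + _].
  by rewrite phi_klein // !gam_klein; [apply | lia | lia].
- move=> i b2 b1; rewrite fE gamlr_layerE.
  have := subscript_below p_pr pB cBB (sMB l) (i := i).
  by rewrite /= !MM; apply.
move=> r; have := subscript_count p_pr pB cBB (sMB l) r.
rewrite /= !MM => le; apply: leq_trans le; apply: eq_leq; apply: eq_card => i.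
by rewrite !inE fE gamlr_layerE.
Qed.

(** The sizes of gamma^l and gamma^(l-1) differ by the logarithm of the index of p^l A in p^(l-1) A,
    which is row l of the type of A. *)
Lemma nbox_klein (T' : tableau) l : 0 < l ->
    gam T' l = g l -> gam T' l.-1 = g l.-1 ->
  nbox T' l = conj (typ p A) l.
Proof.
case: l => // l _ gl gl1; rewrite /nbox /isbox gl gl1 /=.
have := card_boxes (strip_g l) (leq_size_nth (pg l) (pg l.+1) _) (leqnn _).
move=> /(_ (fun i => (andP (strip_g l i)).1)).
have := sumn_quotient pB cBB (sMB l); have := sumn_quotient pB cBB (sMB l.+1).
have := conj_typ p_pr l pA cA.
by move=> /=; lia.
Qed.

End KleinTableau.

Section TableauOfEmbedding.

Variables (p : nat) (gT : finGroupType) (B : {group gT}).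
Hypotheses (p_pr : prime p) (pB : p.-group B) (cBB : abelian B).
Implicit Types U : {group gT}.

(** Quotients fix the partitions and [stripe_subscript_le] fixes the subscripts of boxes; [is_klein]
    fixes the list lengths and the zeros stored outside the stripes. *)
Lemma has_klein_inj U T T' : nst T = nst T' -> is_klein T -> is_klein T' ->
  has_klein p U B T -> has_klein p U B T' -> T = T'.
Proof.
move=> eqn [[s1 s2 pT] stT _ fT] [[s1' s2' pT'] stT' _ fT'].
move=> /has_kleinE[sUB _ gT0 phT] /has_kleinE[_ _ gT0' phT'].
rewrite -eqn in s2' pT' stT' fT' gT0' phT'.
have eqg j : j <= nst T -> gam T j = gam T' j by move=> lej; rewrite gT0 // gT0'.
have size1 (T0 : tableau) : 0 < size T0.1 -> size T0.1 = (nst T0).+1.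
  by move=> s0; rewrite /nst prednK.
case: T T' eqn s1 s2 pT stT fT gT0 phT s1' s2' pT' stT' fT' gT0' phT' eqg
  => [gs phs] [gs' phs'] eqn s1 s2 pT stT fT gT0 phT s1' s2' pT' stT' fT' gT0' phT' eqg.
have eqgs : gs = gs'.
  apply: (eq_from_nth (x0 := [::])).
    by rewrite (size1 (gs, phs)) // (size1 (gs', phs')) // eqn.
  by move=> j ltj; apply: (eqg j); rewrite -ltnS -(size1 (gs, phs)).
congr (_, _) => //; apply: (eq_from_nth (x0 := [::])); first by rewrite s2 s2'.
move=> j ltj; rewrite s2 in ltj; set T := (gs, phs) in eqn s1 s2 pT stT fT gT0 phT eqg ltj s2' pT' stT' fT' gT0' phT'.
set T' := (gs', phs') in eqn eqg s1' s2' stT' fT' gT0' phT' pT'.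
have lel : 1 < j.+2 <= nst T by lia.
have lel1 : j.+2 <= nst T by lia.
have lel2 : j.+1 <= nst T by lia.
suff : phi T j.+2 = phi T' j.+2 by rewrite /phi subn2.
have [[sz nob] _ _ _ _] := fT _ lel; have [[sz' nob'] _ _ _ _] := fT' _ lel.
have st := phT _ lel; have st' := phT' _ lel.
apply: (eq_from_nth (x0 := 0)); first by rewrite sz sz' eqg.
move=> i _; have [bi | nbi] := boolP (isbox T j.+2 i); last first.
  have e1 := nob i nbi; rewrite /sub in e1; rewrite e1.
  have nbi' : ~~ isbox T' j.+2 i by rewrite /isbox -!eqg.
  by have := nob' i nbi'; rewrite /sub => ->.
have st12 : strip (gam T j.+1) (gam T j.+2) by move=> k; apply: (stT j.+2 k); lia.
have h0 : gamlr p U B j.+2 0 = gam T j.+1.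
  rewrite (gamlr_layer pB cBB sUB) gamlr_sub0 ?(subset_trans (Mho_sub _ _)) //.
  rewrite gT0 //= (Mho_add 1 j (pgroupS sUB pB) (abelianS sUB cBB)) //.
rewrite -!eqg // in st'.
have le1 := stripe_subscript_le _ (pT _ lel2) (pT _ lel1) st12 h0 st bi.
have le2 := stripe_subscript_le _ (pT _ lel2) (pT _ lel1) st12 h0 st' bi.
by apply/eqP; rewrite eqn_leq le1 -le2 leqnn le2 -le1 leqnn.
Qed.

Lemma conj_eq0 l m : is_partition l -> head 0 l < m -> conj l m = 0.
Proof.
move=> pl lt; apply/eqP; rewrite -leqn0 leqNgt ltn_conj ?(leq_ltn_trans _ lt) //.
by rewrite nth0 -ltnNge.
Qed.

Lemma typ_of_tableau U T alpha beta gamma : is_partition alpha ->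
    klein_type T alpha beta gamma -> has_klein p U B T ->
  typ p U = alpha /\ typ p (B / U) = gamma.
Proof.
move=> pa [nT _ _ g0 cT] [sUB Ue gU _]; split; last first.
  by rewrite -g0 gU // Mho0.
have pU := pgroupS sUB pB; have cU := abelianS sUB cBB.
apply: eq_partition_conj => //; first exact: typ_partition.
move=> m; have [lem | ltm] := leqP m.+1 (nst T).
  by rewrite cT // (nbox_klein p_pr pB cBB sUB) //; apply: gU; lia.
rewrite [RHS]conj_eq0 -?nT //; have := conj_typ p_pr m pU cU.
have M1 k : nst T <= k -> 'Mho^k(U) = 1.
  by move=> lek; apply/trivgP; rewrite -Ue; apply: Mho_leq.
rewrite !M1 ?cards1 ?logn1 //; [by lia | exact: ltnW].
Qed.

Lemma Mho_head_typ U : p.-group U -> abelian U -> 'Mho^(head 0 (typ p U))(U) = 1.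
Proof.
move=> pU cU; have := sum_minn_typ p_pr (head 0 (typ p U)) pU cU.
rewrite -(sumn_typ pU cU) sumnE (eq_big_seq id) => [eqs | x xU].
  move/eqP: eqs; rewrite -[X in _ == X]addn0 eqn_add2l => /eqP lg0.
  apply/eqP; rewrite trivg_card1 (card_pgroup (pgroupS (Mho_sub _ _) pU)).
  by rewrite /= lg0.
have := typ_partition p_pr pU cU; case: (typ p U) xU => //= y l xl pl.
have /(nthP 0)[i lti <-] := xl; apply/minn_idPl; case: i lti => //= i lti.
exact: partition_le_head pl.
Qed.

Lemma klein_tableau_of_type U alpha beta gamma : U \subset B -> typ p U = alpha ->
    typ p B = beta -> typ p (B / U) = gamma ->
  let T := klein_tableau p U B (head 0 alpha) in
  [/\ is_klein T, klein_type T alpha beta gamma & has_klein p U B T].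
Proof.
move=> sUB tU tB tBU T; have pU := pgroupS sUB pB; have cU := abelianS sUB cBB.
have Ue : 'Mho^(head 0 alpha)(U) = 1 by rewrite -tU; apply: Mho_head_typ.
have gE j : j <= head 0 alpha -> gam T j = typ p (B / 'Mho^j(U)) by apply: gam_klein.
have nT : nst T = head 0 alpha by apply: nst_klein.
split; [exact: is_klein_tableau | | exact: has_klein_tableau].
split; rewrite ?nT //.
- by rewrite /= size_map size_iota.
- rewrite gE // Ue -tB; apply/esym/typ_isog; exact: quotient1_isog.
- by rewrite gE // Mho0.
move=> l lel; rewrite (nbox_klein p_pr pB cBB sUB) ?tU //; first by case/andP: lel.
  by apply: gE; case/andP: lel.
by apply: gE; lia.
Qed.

End TableauOfEmbedding.

(** * Summation over tableaux *)

Local Open Scope ring_scope.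

Theorem theorem1 (p : nat) (alpha beta gamma : seq nat) :
  prime p -> is_partition alpha -> is_partition beta -> is_partition gamma ->
  forall L : seq tableau,
    uniq L ->
    (forall T : tableau, T \in L <-> (is_klein T /\ klein_type T alpha beta gamma)) ->
    ((hall p alpha beta gamma)%:R : rat) =
      \sum_(T <- L)
        \prod_(2 <= l < (head 0%N alpha).+2)
          ((autS_tab p (restr T 1 l))%:R / (autS_tab p (restr T 2 l))%:R : rat).
Proof.
move=> p_pr pa pb pg L uL LP; pose M := [set: Mty p beta]%G.
have pM : p.-group M by apply: Mty_pgroup.
have cM : abelian M by apply: Mty_abelian.
have tM : typ p M = beta by apply: typ_Mty.
rewrite (eq_big_seq (fun T => #|[set U : {group Mty p beta} | `[< has_klein p U M T >]]|%:R)).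
  rewrite -natr_sum; congr (_%:R); rewrite /hall -sum1dep_card big_mkcond /=.
  rewrite [RHS](eq_bigr (fun T => \sum_(U : {group Mty p beta}) `[< has_klein p U M T >] : nat)%N).
    (* After exchanging sums, a subgroup U contributes the number of members of L that are its
       tableau: exactly one if U and its quotient have the prescribed types, none otherwise. *)
    rewrite exchange_big /=; apply: eq_bigr => U _.
    have -> : (\sum_(T <- L) `[< has_klein p U M T >] = count (fun T => `[< has_klein p U M T >]) L)%N.
      by rewrite -sum1_count [RHS]big_mkcond; apply: eq_bigr => T _; case: asboolP.
    case: ifP => [/andP[/eqP tU /eqP tMU] | ntU].
      have [kT ktT hT] := klein_tableau_of_type p_pr pM cM (subsetT U) tU tM tMU.
      set T0 := klein_tableau _ _ _ _ in kT ktT hT.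
      have LT0 : T0 \in L by apply/LP.
      rewrite (eq_in_count (a2 := pred1 T0)) ?count_uniq_mem ?LT0 // => T /LP[kT' ktT'] /=.
      apply/asboolP/eqP => [hT' | -> //].
      have eqn : nst T = nst T0 by case: ktT' => -> _ _ _ _; case: ktT => -> _ _ _ _.
      exact: (has_klein_inj p_pr pM cM eqn kT' kT hT' hT).
    rewrite (eq_in_count (a2 := pred0)) ?count_pred0 // => T /LP[_ ktT'] /=.
    apply/asboolP => hT'; have [tU tMU] := typ_of_tableau p_pr pM cM pa ktT' hT'.
    by rewrite tU tMU !eqxx in ntU.
  by move=> T _; rewrite -sum1dep_card big_mkcond; apply: eq_bigr => U _; case: asboolP.
move=> T /LP[_ [nT _ gb _ _]]; rewrite (card_klein_tableau p_pr pM cM); last by rewrite tM.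
by rewrite nT.
Qed.
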